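(* Let $E$ be a set of equations such that $s^n(0)\not\approx_E s^m(0)$ whenever $n\neq m$ (and $\mathbf{0}\not\approx_E\mathbf{1}$). If $n\in\mathbb{N}$ and $t$ is a $\lambda\mu^{++}$-term with $\vdash' t:\mathrm{Ent}[s^n(0)]$ (empty context, with respect to $E$), then $t\rightarrow_{\mu^{++}}\{\widehat{n}\}$, i.e. $t\rightharpoonup_{\mu^{++}}\widehat{n}$ and $\widehat{n}$ is the only normal term $u$ with $t\rightharpoonup_{\mu^{++}}u$.
   Context: $\lambda\mu^{++}$-terms: $t ::= x \mid \alpha \mid \lambda x\,t \mid \mu\alpha\,t \mid (t\;t)$ ($x$ $\lambda$-variables, $\alpha$ $\mu$-variables, disjoint sets; $\lambda,\mu$ binders). $\mathbf{id}=\lambda x\,x$. One-step reduction $\rightharpoonup$ is the contextual closure of: $(C_\lambda)$ $(\lambda x\,u\;v)\rightharpoonup u[x:=v]$; $(C_\mu)$ $(\mu\alpha\,u\;v)\rightharpoonup \mu\beta\,u[\alpha:=\lambda y\,(\beta\;(y\;v))]$ ($\beta,y$ fresh); $(S_1)$ $((\alpha\;u)\;v)\rightharpoonup(\alpha\;u)$; $(S_2)$ $\mu\alpha\mu\beta\,u\rightharpoonup\mu\alpha\,u[\beta:=\mathbf{id}]$; $(S_3)$ $(\alpha\;(\beta\;u))\rightharpoonup(\beta\;u)$; $(S_4)$ $(\beta\;\mu\alpha\,u)\rightharpoonup u[\alpha:=\lambda y\,(\beta\;y)]$; $(S_5)$ $\mu\alpha\,u\rightharpoonup\lambda z\,\mu\beta\,u[\alpha:=\lambda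 y\,(\beta\;(y\;z))]$ if $u$ contains a subterm $(\alpha\;\lambda x\,v)$; $(S_6)$ $\mu\alpha\,u[y:=(\alpha\;v)]\rightharpoonup v$ if $y$ is free in $u$ and $\alpha$ is not free in $v$. $t\rightharpoonup_{\mu^{++}}t'$ means $t'$ is reached from $t$ in finitely many (possibly zero) steps; a term is normal if no step applies. For a set $\mathcal V$ of normal terms, $t\rightarrow_{\mu^{++}}\mathcal V$ means: $t\rightharpoonup_{\mu^{++}}u$ for every $u\in\mathcal V$, and every normal $u$ with $t\rightharpoonup_{\mu^{++}}u$ is in $\mathcal V$. Types: second-order formulas built with $\perp,\rightarrow,\forall x,\forall X$; $\neg A=A\rightarrow\perp$; $\{A_1,\dots,A_n\rightarrow A\}$ abbreviates $A_1\rightarrow(\dots\rightarrow(A_n\rightarrow A))$. $0$ is a constant, $s$ a unary function symbol, $\mathbf 0,\mathbf 1$ constants. $\mathrm{Ent}[x]=\forall X\,\{X(0),\forall y\,(X(y)\rightarrow X(sy))\rightarrow X(x)\}$. Church integers: $\widehat{n}=\lambda x\lambda y\,(y^n\;x)$ with $(y^0\;x)=x$, $(y^{k+1}\;x)=(y\;(y^k\;x))$. $\approx_E$ is the smallest equivalence relation with $a[\vec x:=\vec t]\approx_E b[\vec x:=\vec t]$ for every equation $a=b$ in $E$. Contexts $\Gamma=x_1:A_1,\dots,x_n:A_n,\alpha_1:\neg B_1,\dots,\alpha_m:\neg B_m$; $\Gamma\vdash' t:A$ is generated by: (1) $\Gamma\vdash' x_i:A_i$, $\Gamma\vdash'\alpha_j:\neg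 B_j$; (2) from $\Gamma,x:A\vdash' u:B$ infer $\Gamma\vdash'\lambda x\,u:A\rightarrow B$; (3) from $\Gamma_1\vdash' u:A\rightarrow B$, $\Gamma_2\vdash' v:A$ infer $\Gamma_1,\Gamma_2\vdash'(u\;v):B$; (4) from $\Gamma\vdash' u:A$, $x$ not free in $\Gamma$, infer $\Gamma\vdash' u:\forall x\,A$; (5) from $\Gamma\vdash' u:\forall x\,A$ infer $\Gamma\vdash' u:A[x:=a]$; (6) from $\Gamma\vdash' u:A$, $X$ not free in $\Gamma$, infer $\Gamma\vdash' u:\forall X\,A$; (7) from $\Gamma\vdash' u:\forall X\,A$ infer $\Gamma\vdash' u:A[X:=G]$; (8) from $\Gamma\vdash' u:A[x:=a]$ and $a\approx_E b$ infer $\Gamma\vdash' u:A[x:=b]$; (9) from $\Gamma,\alpha:\neg B\vdash' u:\perp$ infer $\Gamma\vdash'\mu\alpha\,u:B$.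
   Formalization: ≈_E is taken as the smallest congruence (compatible with function symbols), not merely the smallest equivalence relation, containing the instances of E; with the literal reading, E = {ss𝟎=0, ss𝟏=s0, s𝟎=s𝟏} meets the hypotheses but gives the Church integer 0 type Ent[s0]. *)

(* Defs.v *)
(* MathComp, plus the closure operator [clos_refl_trans] of Stdlib. *)
From Stdlib Require Export Relation_Operators.
From mathcomp Require Export all_boot.

Set Implicit Arguments.
Unset Strict Implicit.
Unset Printing Implicit Defensive.

Definition scons (T : Type) (a : T) (f : nat -> T) (n : nat) : T :=
  if n is m.+1 then f m else a.

(** * Terms *)

(* Terms up to renaming of bound variables, in de Bruijn style.  The
   lambda-variables and the mu-variables are two independent families of
   indices: [Lam] binds [Lvar 0] and leaves the mu-indices alone, [Mu] binds
   [Mvar 0] and leaves the lambda-indices alone. *)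
Inductive term : Type :=
  | Lvar of nat
  | Mvar of nat
  | Lam of term
  | Mu of term
  | App of term & term.

Definition upren (r : nat -> nat) : nat -> nat := scons 0 (fun n => (r n).+1).

Fixpoint ren (r s : nat -> nat) (t : term) : term :=
  match t with
  | Lvar x => Lvar (r x)
  | Mvar a => Mvar (s a)
  | Lam u => Lam (ren (upren r) s u)
  | Mu u => Mu (ren r (upren s) u)
  | App u v => App (ren r s u) (ren r s v)
  end.

Definition lshift : term -> term := ren succn id.
Definition mshift : term -> term := ren id succn.

(* Simultaneous capture-avoiding substitution: [s] for the lambda-variables,
   [m] for the mu-variables (which are themselves terms). *)
Fixpoint subst (s m : nat -> term) (t : term) : term :=
  match t with
  | Lvar x => s x
  | Mvar a => m a
  | Lam u => Lam (subst (scons (Lvar 0) (fun x => lshift (s x)))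
                        (fun a => lshift (m a)) u)
  | Mu u => Mu (subst (fun x => mshift (s x))
                      (scons (Mvar 0) (fun a => mshift (m a))) u)
  | App u v => App (subst s m u) (subst s m v)
  end.

Definition tid : term := Lam (Lvar 0).

Fixpoint lfree (x : nat) (t : term) : bool :=
  match t with
  | Lvar y => y == x
  | Mvar _ => false
  | Lam u => lfree x.+1 u
  | Mu u => lfree x u
  | App u v => lfree x u || lfree x v
  end.

(* [t] contains a subterm (a (lambda x v)), [a] being a free mu-variable. *)
Fixpoint applied_to_lam (a : nat) (t : term) : bool :=
  match t with
  | Lvar _ | Mvar _ => false
  | Lam u => applied_to_lam a u
  | Mu u => applied_to_lam a.+1 u
  | App u v => [|| (if (u, v) is (Mvar b, Lam _) then b == a else false),
                   applied_to_lam a u | applied_to_lam a v]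
  end.

(** * Reduction *)

(* In [C_mu] and [S5] the mu-binder of the redex is replaced by another one
   (beta), so the remaining mu-variables a.+1 keep their index; in [S2] and
   [S4] the binder of the substituted variable disappears, so a.+1 becomes a.
   [S5] puts its result under a new lambda z, whence the shift of the
   lambda-variables; there z is [Lvar 1] under the inner lambda y.
   In [S6], [u] has one more free lambda-variable y (index 0) than the body of
   the redex, and [mshift v] expresses that alpha is not free in v. *)
Inductive contract : term -> term -> Prop :=
  | C_lambda u v :
      contract (App (Lam u) v) (subst (scons v Lvar) Mvar u)
  | C_mu u v :
      contract (App (Mu u) v)
        (Mu (subst Lvar
               (scons (Lam (App (Mvar 0) (App (Lvar 0) (lshift (mshift v)))))
                      (fun a => Mvar a.+1)) u))
  | S1 a u v :
      contract (App (App (Mvar a) u) v) (App (Mvar a) u)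
  | S2 u :
      contract (Mu (Mu u)) (Mu (subst Lvar (scons tid Mvar) u))
  | S3 a b u :
      contract (App (Mvar a) (App (Mvar b) u)) (App (Mvar b) u)
  | S4 b u :
      contract (App (Mvar b) (Mu u))
        (subst Lvar (scons (Lam (App (Mvar b) (Lvar 0))) Mvar) u)
  | S5 u :
      applied_to_lam 0 u ->
      contract (Mu u)
        (Lam (Mu (subst (fun x => Lvar x.+1)
                   (scons (Lam (App (Mvar 0) (App (Lvar 0) (Lvar 1))))
                          (fun a => Mvar a.+1)) u)))
  | S6 u v :
      lfree 0 u ->
      contract (Mu (subst (scons (App (Mvar 0) (mshift v)) Lvar) Mvar u)) v.

Inductive red : term -> term -> Prop :=
  | red_contract t t' : contract t t' -> red t t'
  | red_lam u u' : red u u' -> red (Lam u) (Lam u')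
  | red_mu u u' : red u u' -> red (Mu u) (Mu u')
  | red_appl u u' v : red u u' -> red (App u v) (App u' v)
  | red_appr u v v' : red v v' -> red (App u v) (App u v').

Definition reds : term -> term -> Prop := clos_refl_trans term red.

Definition normal (t : term) : Prop := forall t', ~ red t t'.

Definition reds_to_set (t : term) (V : term -> Prop) : Prop :=
  [/\ forall u, V u -> normal u,
      forall u, V u -> reds t u
    & forall u, normal u -> reds t u -> V u].

(* lambda x lambda y (y^n x): x is [Lvar 1] and y is [Lvar 0] in the body. *)
Definition church (n : nat) : term :=
  Lam (Lam (iter n (App (Lvar 0)) (Lvar 1))).

(** * First-order terms and second-order formulas *)

Section Types.

(* The language contains the constants 0, bold 0, bold 1, the unary symbol s,
   and an arbitrary family [F] of further function symbols with arities [ar]. *)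
Variables (F : Type) (ar : F -> nat).

Inductive fterm : Type :=
  | FVar of nat
  | FZero
  | FSucc of fterm
  | FBool0
  | FBool1
  | FApp (f : F) of ('I_(ar f) -> fterm).

Fixpoint ftsubst (th : nat -> fterm) (a : fterm) : fterm :=
  match a with
  | FVar n => th n
  | FZero => FZero
  | FSucc b => FSucc (ftsubst th b)
  | FBool0 => FBool0
  | FBool1 => FBool1
  | FApp f args => FApp (fun j => ftsubst th (args j))
  end.

Definition numeral (n : nat) : fterm := iter n FSucc FZero.

(* Equality modulo [E] is an equational theory, hence compatible with the
   function symbols.  Without this closure, E = {f(c) = 0, f(d) = s(0), c = d}
   would keep 0 and s(0) apart, whereas the typing rule [T_eq] below, which
   replaces equals inside types, would identify Ent[0] and Ent[s(0)].
   On the types derivable with [T_eq] the closure has no effect. *)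
Inductive eqE (E : fterm -> fterm -> Prop) : fterm -> fterm -> Prop :=
  | eqE_ax a b th : E a b -> eqE E (ftsubst th a) (ftsubst th b)
  | eqE_refl a : eqE E a a
  | eqE_sym a b : eqE E a b -> eqE E b a
  | eqE_trans a b c : eqE E a b -> eqE E b c -> eqE E a c
  | eqE_succ a b : eqE E a b -> eqE E (FSucc a) (FSucc b)
  | eqE_app f (a b : 'I_(ar f) -> fterm) :
      (forall j, eqE E (a j) (b j)) -> eqE E (FApp a) (FApp b).

(* [PVar k i args] is the atom X(args) for the [i]-th second-order variable X
   of arity [k].  There is one family of indices per arity: [All2 k] binds
   index 0 of arity [k] and leaves the other arities alone. *)
Inductive form : Type :=
  | Bot
  | PVar (k i : nat) of ('I_k -> fterm)
  | Imp of form & form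
  | All1 of form
  | All2 of nat & form.

Definition Neg (A : form) : form := Imp A Bot.

Definition up1 (th : nat -> fterm) : nat -> fterm :=
  scons (FVar 0) (fun n => ftsubst (fun m => FVar m.+1) (th n)).

Fixpoint subst1 (th : nat -> fterm) (A : form) : form :=
  match A with
  | Bot => Bot
  | PVar k i args => PVar i (fun j => ftsubst th (args j))
  | Imp B C => Imp (subst1 th B) (subst1 th C)
  | All1 B => All1 (subst1 (up1 th) B)
  | All2 k B => All2 k (subst1 th B)
  end.

Definition shift1 : form -> form := subst1 (fun n => FVar n.+1).
Definition inst1 (a : fterm) : form -> form := subst1 (scons a FVar).

(* Operations on a family indexed by arity and index, under [All2 k]. *)
Definition scons2 (T : Type) (k : nat) (a : T) (f : nat -> nat -> T)
    (k' : nat) : nat -> T :=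
  if k' == k then scons a (f k') else f k'.

Fixpoint ren2 (r : nat -> nat -> nat) (A : form) : form :=
  match A with
  | Bot => Bot
  | PVar k i args => PVar (r k i) args
  | Imp B C => Imp (ren2 r B) (ren2 r C)
  | All1 B => All1 (ren2 r B)
  | All2 k B =>
      All2 k (ren2 (fun k' => if k' == k then upren (r k') else r k') B)
  end.

Definition shift2 (k : nat) : form -> form :=
  ren2 (fun k' i => if k' == k then i.+1 else i).

(* A formula with [k] distinguished parameters is a formula whose first-order
   indices 0, ..., k-1 are the parameters, the index k + n standing for the
   ambient variable n. *)
Definition apply_params (k : nat) (args : 'I_k -> fterm) (G : form) : form :=
  subst1 (fun n => if insub n is Some j then args j else FVar (n - k)) G.

Definition shift1_params (k : nat) : form -> form :=
  subst1 (fun n => FVar (if n < k then n else n.+1)).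

(* [s k i] is the formula, with [k] parameters, replacing the [i]-th
   second-order variable of arity [k]. *)
Fixpoint subst2 (s : nat -> nat -> form) (A : form) : form :=
  match A with
  | Bot => Bot
  | PVar k i args => apply_params args (s k i)
  | Imp B C => Imp (subst2 s B) (subst2 s C)
  | All1 B => All1 (subst2 (fun k i => shift1_params k (s k i)) B)
  | All2 k B =>
      All2 k (subst2 (scons2 k (PVar 0 (fun j : 'I_k => FVar j))
                             (fun k' i => shift2 k (s k' i))) B)
  end.

Definition inst2 (k : nat) (G : form) : form -> form :=
  subst2 (scons2 k G (fun k' i => PVar i (fun j : 'I_k' => FVar j))).

(* Ent[a]; the only first-order binder is that of y, which is not above [a]. *)
Definition Ent (a : fterm) : form :=
  let X (b : fterm) := @PVar 1 0 (fun _ => b) in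
  All2 1 (Imp (X FZero)
         (Imp (All1 (Imp (X (FVar 0)) (X (FSucc (FVar 0)))))
              (X a))).

(** * Typing *)

Definition ctx : Type := nat -> option form.

Definition empty : ctx := fun _ => None.

(* [G] is the union of the sets of declarations [G1] and [G2]. *)
Definition ctx_union (G1 G2 G : ctx) : Prop :=
  forall x A, G x = Some A <-> G1 x = Some A \/ G2 x = Some A.

Definition ctx_map (f : form -> form) (G : ctx) : ctx := fun x => omap f (G x).

(* [G] declares the lambda-variables and [D] the mu-variables;
   [D a = Some B] stands for the declaration a : not B.  The side conditions
   "not free in the context" of the generalization rules are expressed by
   shifting the context in the premise. *)
Inductive typed (E : fterm -> fterm -> Prop) :
    ctx -> ctx -> term -> form -> Prop :=
  | T_lvar (G D : ctx) x A : G x = Some A -> typed E G D (Lvar x) A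
  | T_mvar (G D : ctx) a B : D a = Some B -> typed E G D (Mvar a) (Neg B)
  | T_lam (G D : ctx) u A B :
      typed E (scons (Some A) G) D u B -> typed E G D (Lam u) (Imp A B)
  | T_app (G1 G2 G D1 D2 D : ctx) u v A B :
      ctx_union G1 G2 G -> ctx_union D1 D2 D ->
      typed E G1 D1 u (Imp A B) -> typed E G2 D2 v A ->
      typed E G D (App u v) B
  | T_all1I (G D : ctx) u A :
      typed E (ctx_map shift1 G) (ctx_map shift1 D) u A ->
      typed E G D u (All1 A)
  | T_all1E (G D : ctx) u A a :
      typed E G D u (All1 A) -> typed E G D u (inst1 a A)
  | T_all2I (G D : ctx) u k A :
      typed E (ctx_map (shift2 k) G) (ctx_map (shift2 k) D) u A ->
      typed E G D u (All2 k A)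
  | T_all2E (G D : ctx) u k A H :
      typed E G D u (All2 k A) -> typed E G D u (inst2 k H A)
  | T_eq (G D : ctx) u A a b :
      typed E G D u (inst1 a A) -> eqE E a b -> typed E G D u (inst1 b A)
  | T_mu (G D : ctx) u B :
      typed E G (scons (Some B) D) u Bot -> typed E G D (Mu u) B.

End Types.

Arguments FVar {F ar} _.
Arguments FZero {F ar}.
Arguments FBool0 {F ar}.
Arguments FBool1 {F ar}.
Arguments Bot {F ar}.
Arguments numeral {F ar} n.
Arguments empty {F ar} _.

(* Main.v *)
(* Subject reduction fails for [S4] with Curry-style quantifiers, so that the
   proof is semantic. Terms are extended with constants denoting stacks, and a
   formula is interpreted by the terms that are safe against its stacks: all
   their reducts keep the shape expected of a term of type bot and can still
   reach an answer. A mu-variable is instantiated by a stack constant, which is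
   inert, so that every step of a term is a step of its instance. Safety is
   closed under reduction by definition, and its closure under the typing rules
   is proved by coinduction along the reducts; no normalization is needed.
   Interpreting X(a) by the stack of the integer n when a is s^n(0) modulo E,
   every reduct u of a term t : Ent[s^n(0)] is safe against the stack with
   arguments x and f. Then u reduces to some lambda x u1, since it can reach a
   value, then u1 to some lambda f u2, and u2 to (f^n x). For u = t this gives
   the reduction, and for u normal it gives the uniqueness. *)

Require Import Defs.
From Stdlib Require List.
From Stdlib Require Import FunctionalExtensionality PropExtensionality.
From Stdlib Require Import Classical Operators_Properties.

Set Implicit Arguments.
Unset Strict Implicit.
Unset Printing Implicit Defensive.

(** * Terms with constants *)

(* [Zero] and [Next] are the arguments given to an integer. The stack
   constants [Base o] and [Push v k] are substituted for mu-variables: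
   [Base None] stands for a variable of type not bot, [Base (Some n)] for one
   of type not X(s^n 0), and [Push v k] for lambda y (k (y v)). [Push] is
   opaque to renaming, substitution and reduction: only closed [v] occur. *)
Inductive xterm : Type :=
  | XL of nat
  | XM of nat
  | XLam of xterm
  | XMu of xterm
  | XApp of xterm & xterm
  | Zero
  | Next
  | Base of option nat
  | Push of xterm & xterm.

Fixpoint xren (r q : nat -> nat) (t : xterm) : xterm :=
  match t with
  | XL x => XL (r x)
  | XM a => XM (q a)
  | XLam u => XLam (xren (upren r) q u)
  | XMu u => XMu (xren r (upren q) u)
  | XApp u v => XApp (xren r q u) (xren r q v)
  | _ => t
  end.

Notation xlshift := (xren succn id).
Notation xmshift := (xren id succn).

Definition lup (s : nat -> xterm) : nat -> xterm :=
  scons (XL 0) (fun x => xlshift (s x)).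
Definition mup (m : nat -> xterm) : nat -> xterm :=
  scons (XM 0) (fun a => xmshift (m a)).

Fixpoint xsubst (s m : nat -> xterm) (t : xterm) : xterm :=
  match t with
  | XL x => s x
  | XM a => m a
  | XLam u => XLam (xsubst (lup s) (fun a => xlshift (m a)) u)
  | XMu u => XMu (xsubst (fun x => xmshift (s x)) (mup m) u)
  | XApp u v => XApp (xsubst s m u) (xsubst s m v)
  | _ => t
  end.

Definition lsub (v : xterm) : xterm -> xterm := xsubst (scons v XL) XM.
Definition msub (k : xterm) : xterm -> xterm := xsubst XL (scons k XM).

Definition isM (t : xterm) : bool :=
  match t with XM _ | Base _ | Push _ _ => true | _ => false end.
Definition isC (t : xterm) : bool :=
  match t with Base _ | Push _ _ => true | _ => false end.
Definition isLam (t : xterm) : bool := if t is XLam _ then true else false.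

Definition closed (t : xterm) : Prop := forall s m, xsubst s m t = t.

Lemma scons_ext (T : Type) (a : T) (f g : nat -> T) :
  g 0 = a -> (forall n, g n.+1 = f n) -> scons a f = g.
Proof.
by move=> g0 gS; apply: functional_extensionality => -[|n]; rewrite /= ?g0 ?gS.
Qed.

Lemma upren_id : upren id = id.
Proof. exact: scons_ext. Qed.

Lemma upren_comp r r' : upren (r \o r') = upren r \o upren r'.
Proof. exact: scons_ext. Qed.

Lemma xren_id t : xren id id t = t.
Proof.
by elim: t => //= [u IH|u IH|u IHu v IHv]; rewrite ?upren_id ?IH ?IHu ?IHv.
Qed.

Lemma xren_xren r q r' q' t :
  xren r q (xren r' q' t) = xren (r \o r') (q \o q') t.
Proof.
elim: t r q r' q' => //= [u IH|u IH|u IHu v IHv] r q r' q'.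
- by rewrite IH upren_comp.
- by rewrite IH upren_comp.
- by rewrite IHu IHv.
Qed.

Lemma xsubst_xren s m r q t :
  xsubst s m (xren r q t) = xsubst (s \o r) (m \o q) t.
Proof.
elim: t s m r q => //= [u IH|u IH|u IHu v IHv] s m r q.
- by rewrite IH; do 2 f_equal; symmetry; apply: scons_ext.
- by rewrite IH; do 2 f_equal; symmetry; apply: scons_ext.
- by rewrite IHu IHv.
Qed.

Lemma xren_xsubst s m r q t :
  xren r q (xsubst s m t) = xsubst (xren r q \o s) (xren r q \o m) t.
Proof.
elim: t s m r q => //= [u IH|u IH|u IHu v IHv] s m r q.
- rewrite IH; do 2 f_equal.
    by symmetry; apply: scons_ext => // n; rewrite /= !xren_xren.
  by apply: functional_extensionality => a; rewrite /= !xren_xren.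
- rewrite IH; do 2 f_equal.
    by apply: functional_extensionality => a; rewrite /= !xren_xren.
  by symmetry; apply: scons_ext => // n; rewrite /= !xren_xren.
- by rewrite IHu IHv.
Qed.

Lemma xren_subst r q t : xren r q t = xsubst (XL \o r) (XM \o q) t.
Proof.
elim: t r q => //= [u IH|u IH|u IHu v IHv] r q.
- by rewrite IH; do 2 f_equal; symmetry; apply: scons_ext.
- by rewrite IH; do 2 f_equal; symmetry; apply: scons_ext.
- by rewrite IHu IHv.
Qed.

Lemma xsubst_id t : xsubst XL XM t = t.
Proof. by rewrite -[RHS]xren_id xren_subst. Qed.

Lemma xsubst_xsubst s m s' m' t :
  xsubst s m (xsubst s' m' t) = xsubst (xsubst s m \o s') (xsubst s m \o m') t.
Proof.
elim: t s m s' m' => //= [u IH|u IH|u IHu v IHv] s m s' m'.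
- rewrite IH; do 2 f_equal.
    by symmetry; apply: scons_ext => // n; rewrite /= xsubst_xren xren_xsubst.
  by apply: functional_extensionality => a; rewrite /= xsubst_xren xren_xsubst.
- rewrite IH; do 2 f_equal.
    by apply: functional_extensionality => a; rewrite /= xsubst_xren xren_xsubst.
  by symmetry; apply: scons_ext => // n; rewrite /= xsubst_xren xren_xsubst.
- by rewrite IHu IHv.
Qed.

Lemma xsubst_ext s m s' m' t :
  s =1 s' -> m =1 m' -> xsubst s m t = xsubst s' m' t.
Proof.
by move=> /functional_extensionality-> /functional_extensionality->.
Qed.

Lemma lsub_lshift v t : lsub v (xlshift t) = t.
Proof. by rewrite /lsub xsubst_xren -[RHS]xsubst_id. Qed.

Lemma msub_mshift k t : msub k (xmshift t) = t.
Proof. by rewrite /msub xsubst_xren -[RHS]xsubst_id. Qed.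

Lemma xlshift_subst s m t :
  xsubst (lup s) (fun a => xlshift (m a)) (xlshift t) = xlshift (xsubst s m t).
Proof. by rewrite xsubst_xren xren_xsubst. Qed.

Lemma xmshift_subst s m t :
  xsubst (fun x => xmshift (s x)) (mup m) (xmshift t) = xmshift (xsubst s m t).
Proof. by rewrite xsubst_xren xren_xsubst. Qed.

Lemma xlshift_inj : injective xlshift.
Proof. by move=> t u /(congr1 (lsub (XL 0))); rewrite !lsub_lshift. Qed.

Lemma xmshift_inj : injective xmshift.
Proof. by move=> t u /(congr1 (msub (XM 0))); rewrite !msub_mshift. Qed.

Lemma closed_ren r q t : closed t -> xren r q t = t.
Proof. by move=> ct; rewrite xren_subst. Qed.

Lemma isC_closed k : isC k -> closed k.
Proof. by case: k. Qed.

Lemma isC_isM k : isC k -> isM k.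
Proof. by case: k. Qed.

Lemma closed_subst s m t :
  (forall x, closed (s x)) -> (forall a, closed (m a)) -> closed (xsubst s m t).
Proof.
move=> cs cm s' m'; rewrite xsubst_xsubst; apply: xsubst_ext => x /=.
  exact: cs.
exact: cm.
Qed.

Lemma isM_subst s m h : isM h -> (forall a, isM (m a)) -> isM (xsubst s m h).
Proof. by case: h => //= a _ /(_ a). Qed.

Lemma isM_xren r q h : isM h -> isM (xren r q h).
Proof. by case: h. Qed.

Lemma isM_lshift h : isM h -> xlshift h = h.
Proof. by case: h. Qed.

Lemma isM_mup (m : nat -> xterm) : (forall a, isM (m a)) -> forall a, isM (mup m a).
Proof. by move=> mM [|a] //=; apply: isM_xren. Qed.

Fixpoint lfr (x : nat) (t : xterm) : bool :=
  match t with
  | XL y => y == x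
  | XLam u => lfr x.+1 u
  | XMu u => lfr x u
  | XApp u v => lfr x u || lfr x v
  | _ => false
  end.

Fixpoint mfr (a : nat) (t : xterm) : bool :=
  match t with
  | XM b => b == a
  | XLam u => mfr a u
  | XMu u => mfr a.+1 u
  | XApp u v => mfr a u || mfr a v
  | _ => false
  end.

Lemma xren_fixed r q t :
  (forall x, lfr x t -> r x = x) -> (forall a, mfr a t -> q a = a) ->
  xren r q t = t.
Proof.
elim: t r q => //= [x|a|u IH|u IH|u IHu v IHv] r q rE qE.
- by rewrite rE.
- by rewrite qE.
- by rewrite IH // => -[|x] //= /rE->.
- by rewrite IH // => -[|x] //= /qE->.
- by rewrite IHu ?IHv // => x fx; rewrite ?rE ?qE // fx ?orbT.
Qed.

Lemma lfr_shift t : ~~ lfr 0 t -> exists t', t = xlshift t'.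
Proof.
move=> t0; exists (xren predn id t); rewrite xren_xren.
by rewrite xren_fixed // => -[|x] //= h; rewrite h in t0.
Qed.

Lemma mfr_shift t : ~~ mfr 0 t -> exists t', t = xmshift t'.
Proof.
move=> t0; exists (xren id predn t); rewrite xren_xren.
by rewrite xren_fixed // => -[|x] //= h; rewrite h in t0.
Qed.

Lemma lfr_subst s m t x y : lfr x t -> s x = XL y -> lfr y (xsubst s m t).
Proof.
elim: t s m x y => //= [z|u IH|u IH|u IHu v IHv] s m x y.
- by move=> /eqP-> -> /=.
- by move=> ux sx; apply: IH ux _; rewrite /= sx.
- by move=> ux sx; apply: IH ux _; rewrite /= sx.
- by case/orP => [/IHu|/IHv] h /h->; rewrite ?orbT.
Qed.

Lemma mfr_subst s m t a b : mfr a t -> m a = XM b -> mfr b (xsubst s m t).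
Proof.
elim: t s m a b => //= [z|u IH|u IH|u IHu v IHv] s m a b.
- by move=> /eqP-> -> /=.
- by move=> ux sx; apply: IH ux _; rewrite /= sx.
- by move=> ux sx; apply: IH ux _; rewrite /= sx.
- by case/orP => [/IHu|/IHv] h /h->; rewrite ?orbT.
Qed.

Lemma lfr_ren r q t x : lfr x (xren r q t) -> exists2 y, lfr y t & r y = x.
Proof.
elim: t r q x => //= [z|u IH|u IH|u IHu v IHv] r q x.
- by move/eqP=> <-; exists z.
- by case/IH => -[|y] //= uy [<-]; exists y.
- by case/IH => y; exists y.
- by case/orP => [/IHu|/IHv] [y h <-]; exists y; rewrite ?h ?orbT.
Qed.

Lemma mfr_ren r q t x : mfr x (xren r q t) -> exists2 y, mfr y t & q y = x.
Proof.
elim: t r q x => //= [z|u IH|u IH|u IHu v IHv] r q x.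
- by move/eqP=> <-; exists z.
- by case/IH => y; exists y.
- by case/IH => -[|y] //= uy [<-]; exists y.
- by case/orP => [/IHu|/IHv] [y h <-]; exists y; rewrite ?h ?orbT.
Qed.

Lemma lfr_lshift t : ~~ lfr 0 (xlshift t).
Proof. by apply/negP => /lfr_ren [y]. Qed.

Lemma mfr_mshift t : ~~ mfr 0 (xmshift t).
Proof. by apply/negP => /mfr_ren [y]. Qed.

Lemma lshift_inv (s m : nat -> xterm) t u :
  xlshift t = xsubst (lup s) (fun a => xlshift (m a)) u ->
  exists2 v, u = xlshift v & t = xsubst s m v.
Proof.
move=> e; have : ~~ lfr 0 u.
  apply/negP => /(lfr_subst (s := lup s) (fun a => xlshift (m a)))/(_ erefl).
  by rewrite -e (negbTE (lfr_lshift t)).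
case/lfr_shift => v ev; exists v => //; apply: xlshift_inj.
by rewrite -xlshift_subst -ev.
Qed.

Lemma mshift_inv (s m : nat -> xterm) t u :
  xmshift t = xsubst (fun x => xmshift (s x)) (mup m) u ->
  exists2 v, u = xmshift v & t = xsubst s m v.
Proof.
move=> e; have : ~~ mfr 0 u.
  apply/negP => /(mfr_subst (fun x => xmshift (s x)) (m := mup m))/(_ erefl).
  by rewrite -e (negbTE (mfr_mshift t)).
case/mfr_shift => v ev; exists v => //; apply: xmshift_inj.
by rewrite -xmshift_subst -ev.
Qed.

(* [occ t u]: [t] is a subterm of [u] none of whose free variables is bound
   in [u], i.e. [u] is some [u0[y := t]] with [y] free in [u0], as in [S6]. *)
Inductive occ : xterm -> xterm -> Prop :=
  | occ_refl t : occ t t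
  | occ_lam t u : occ (xlshift t) u -> occ t (XLam u)
  | occ_mu t u : occ (xmshift t) u -> occ t (XMu u)
  | occ_appl t u v : occ t u -> occ t (XApp u v)
  | occ_appr t u v : occ t v -> occ t (XApp u v).

Lemma occ_subst s m t u : occ t u -> occ (xsubst s m t) (xsubst s m u).
Proof.
move=> o; elim: o s m => {t u} [t|t u _ IH|t u _ IH|t u v _ IH|t u v _ IH] s m /=.
- exact: occ_refl.
- by apply: occ_lam; rewrite -xlshift_subst.
- by apply: occ_mu; rewrite -xmshift_subst.
- exact: occ_appl.
- exact: occ_appr.
Qed.

(* [t] has a subterm (h (lambda x v)), possibly under binders, where the head
   [h] is a free mu-variable in [P] or a stack constant in [Q]. *)
Fixpoint dlam (P : nat -> bool) (Q : xterm -> bool) (t : xterm) : bool :=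
  match t with
  | XLam u => dlam P Q u
  | XMu u => dlam (scons false P) Q u
  | XApp u v =>
    [|| (if (u, v) is (h, XLam _)
         then (if h is XM b then P b else isC h && Q h) else false),
        dlam P Q u | dlam P Q v]
  | _ => false
  end.

Lemma dlam_subst (P P' : nat -> bool) Q s m t :
  (forall a, P' a -> if m a is XM b then P b : bool else isC (m a) && Q (m a)) ->
  dlam P' Q t -> dlam P Q (xsubst s m t).
Proof.
elim: t s m P P' => //= [u IH|u IH|u IHu v IHv] s m P P' hP.
- by apply: IH => a /hP; case: (m a).
- by apply: IH => -[|a] //= /hP; case: (m a).
- case/or3P => [h|/IHu->|/IHv->]; rewrite ?orbT //.
  case: v h {IHu IHv} => // v h /=; apply/orP; left.
  by case: u h => //= a /hP; case: (m a).
Qed.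

Definition lleaf (t : xterm) : bool :=
  match t with XL _ | Zero | Next => true | _ => false end.

Lemma dlam_subst_inv (P P' : nat -> bool) Q s m t :
  (forall x, lleaf (s x)) -> (forall a, isM (m a)) ->
  (forall a, (if m a is XM b then P b : bool else isC (m a) && Q (m a)) -> P' a) ->
  dlam P Q (xsubst s m t) -> dlam P' Q t.
Proof.
elim: t s m P P' => //= [x|a|u IH|u IH|u IHu v IHv] s m P P' hs hm hP.
- by move: (hs x); case: (s x).
- by move: (hm a); case: (m a).
- move=> h; apply: (IH _ _ _ _ _ _ _ h) => [[|x]|a|a] //=.
  + by move: (hs x); case: (s x).
  + exact: isM_xren.
  + by move: (hP a) (hm a); case: (m a).
- move=> h; apply: (IH _ _ _ _ _ _ _ h) => [x|[|a]|[|a]] //=.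
  + by move: (hs x); case: (s x).
  + exact: isM_xren.
  + by move: (hP a) (hm a); case: (m a).
- case/or3P => [h|/IHu H|/IHv H]; last 2 first.
  + by rewrite (H _ hs hm hP) !orbT.
  + by rewrite (H _ hs hm hP) !orbT.
  case: v h {IHu IHv} => //= [x|a|v h].
  + by move: (hs x); case: (s x).
  + by move: (hm a); case: (m a).
  + case: u h => //= [x|a|o ->|w k ->] //.
      by move: (hs x); case: (s x).
    by move/hP->.
Qed.

(** * Reduction *)

Definition isBot (t : xterm) : bool := if t is Base None then true else false.
Definition isBase (t : xterm) : bool := if t is Base _ then true else false.
Definition isPushN (t : xterm) : bool :=
  if t is Push _ k then ~~ isBot k else false.

Definition clean (t : xterm) : bool := ~~ dlam xpred0 isBase t.

Definition cmu_arg (h v : xterm) : xterm :=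
  XLam (XApp h (XApp (XL 0) (xlshift v))).

(* With [b = false] these are the original rules, the stack constants being
   treated as mu-variables, and the unfolding of [Push v (Base None)]; this is
   the reduction used to state that a term can reach a value. The rules added
   when [b = true] make reachable from [u[alpha := Push v k]] and
   [u[alpha := Base None]] the terms that [C_mu], [S2] and [S4] produce. *)
Inductive xcontract (b : bool) : xterm -> xterm -> Prop :=
  | X_lam u v : xcontract b (XApp (XLam u) v) (lsub v u)
  | X_mu u v :
      xcontract b (XApp (XMu u) v)
        (XMu (xsubst XL (scons (cmu_arg (XM 0) (xmshift v)) (fun a => XM a.+1)) u))
  | X_1 h u v : isM h -> xcontract b (XApp (XApp h u) v) (XApp h u)
  | X_2 u : xcontract b (XMu (XMu u)) (XMu (msub (XLam (XL 0)) u))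
  | X_3 h h' u : isM h -> isM h' ->
      xcontract b (XApp h (XApp h' u)) (XApp h' u)
  | X_4 h u : isM h ->
      xcontract b (XApp h (XMu u)) (msub (XLam (XApp h (XL 0))) u)
  | X_5 u : dlam (pred1 0) xpred0 u ->
      xcontract b (XMu u)
        (XLam (XMu (xsubst (fun x => XL x.+1)
           (scons (XLam (XApp (XM 0) (XApp (XL 0) (XL 1)))) (fun a => XM a.+1)) u)))
  | X_6 u v : occ (XApp (XM 0) (xmshift v)) u -> xcontract b (XMu u) v
  | X_push v k : closed v -> isC k -> b || isBot k ->
      xcontract b (Push v k) (XLam (XApp k (XApp (XL 0) v)))
  | X_eta k : b -> isC k -> xcontract b k (XLam (XApp k (XL 0)))
  | X_bot t : b -> xcontract b (XApp (Base None) t) t.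

Inductive xred (b : bool) : xterm -> xterm -> Prop :=
  | xred_contract t t' : xcontract b t t' -> xred b t t'
  | xred_lam u u' : xred b u u' -> xred b (XLam u) (XLam u')
  | xred_mu u u' : xred b u u' -> xred b (XMu u) (XMu u')
  | xred_appl u u' v : xred b u u' -> xred b (XApp u v) (XApp u' v)
  | xred_appr u v v' : xred b v v' -> xred b (XApp u v) (XApp u v').

Definition xreds b := clos_refl_trans xterm (xred b).

Lemma xreds_refl b t : xreds b t t. Proof. exact: rt_refl. Qed.
Lemma xreds_trans b t u v : xreds b t u -> xreds b u v -> xreds b t v.
Proof. exact: rt_trans. Qed.
Lemma xreds_step b t u : xred b t u -> xreds b t u. Proof. exact: rt_step. Qed.
Lemma xreds_contract b t u : xcontract b t u -> xreds b t u.
Proof. by move=> c; apply/rt_step/xred_contract. Qed.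

Hint Resolve xreds_refl : core.

Lemma xreds_map b b' (f : xterm -> xterm) :
  (forall t u, xred b t u -> xreds b' (f t) (f u)) ->
  forall t u, xreds b t u -> xreds b' (f t) (f u).
Proof.
move=> h t u; elim=> {t u} [t u /h //|t //|t u v _ IH1 _ IH2].
exact: xreds_trans IH1 IH2.
Qed.

Lemma xreds_lam b u u' : xreds b u u' -> xreds b (XLam u) (XLam u').
Proof. by apply: xreds_map => ? ? ?; apply/xreds_step/xred_lam. Qed.
Lemma xreds_mu b u u' : xreds b u u' -> xreds b (XMu u) (XMu u').
Proof. by apply: xreds_map => ? ? ?; apply/xreds_step/xred_mu. Qed.
Lemma xreds_appl b u u' v : xreds b u u' -> xreds b (XApp u v) (XApp u' v).
Proof.
by apply: (xreds_map (f := fun u => XApp u v)) => ? ? ?; apply/xreds_step/xred_appl.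
Qed.
Lemma xreds_appr b u v v' : xreds b v v' -> xreds b (XApp u v) (XApp u v').
Proof. by apply: xreds_map => ? ? ?; apply/xreds_step/xred_appr. Qed.
Lemma xreds_app b u u' v v' :
  xreds b u u' -> xreds b v v' -> xreds b (XApp u v) (XApp u' v').
Proof.
by move=> hu hv; apply: xreds_trans (xreds_appl _ hu) (xreds_appr _ hv).
Qed.

Lemma lsub_subst s m u v :
  xsubst s m (lsub v u) =
  lsub (xsubst s m v) (xsubst (lup s) (fun a => xlshift (m a)) u).
Proof.
rewrite /lsub !xsubst_xsubst; apply: xsubst_ext => [[|x]|a] //=.
  by rewrite -/(lsub _ _) lsub_lshift.
by rewrite -/(lsub _ _) lsub_lshift.
Qed.

Lemma msub_subst s m u k :
  xsubst s m (msub k u) =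
  msub (xsubst s m k) (xsubst (fun x => xmshift (s x)) (mup m) u).
Proof.
rewrite /msub !xsubst_xsubst; apply: xsubst_ext => [x|[|a]] //=.
  by rewrite -/(msub _ _) msub_mshift.
by rewrite -/(msub _ _) msub_mshift.
Qed.

Lemma cmu_subst s m (mM : forall a, isM (m a)) u v :
  xsubst (fun x => xmshift (s x)) (mup m)
    (xsubst XL (scons (cmu_arg (XM 0) (xmshift v)) (fun a => XM a.+1)) u) =
  xsubst XL (scons (cmu_arg (XM 0) (xmshift (xsubst s m v))) (fun a => XM a.+1))
    (xsubst (fun x => xmshift (s x)) (mup m) u).
Proof.
rewrite !xsubst_xsubst; apply: xsubst_ext => [x|[|a]] //=.
- by rewrite xsubst_xren xren_subst; apply: xsubst_ext => -[].
- rewrite /cmu_arg; do 3 f_equal.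
  by rewrite xlshift_subst xmshift_subst.
- by rewrite xsubst_xren xren_subst; apply: xsubst_ext => -[].
Qed.

Lemma s5_subst s m (mM : forall a, isM (m a)) u :
  xsubst (fun x => xmshift (lup s x)) (mup (fun a => xlshift (m a)))
    (xsubst (fun x => XL x.+1)
       (scons (XLam (XApp (XM 0) (XApp (XL 0) (XL 1)))) (fun a => XM a.+1)) u) =
  xsubst (fun x => XL x.+1)
    (scons (XLam (XApp (XM 0) (XApp (XL 0) (XL 1)))) (fun a => XM a.+1))
    (xsubst (fun x => xmshift (s x)) (mup m) u).
Proof.
rewrite !xsubst_xsubst; apply: xsubst_ext => [x|[|a]] //=.
- by rewrite xsubst_xren xren_xren xren_subst; apply: xsubst_ext => -[].
- by rewrite xsubst_xren xren_xren xren_subst; apply: xsubst_ext => -[].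
Qed.

Lemma xcontract_subst b s m t t' : (forall a, isM (m a)) ->
  xcontract b t t' -> xcontract b (xsubst s m t) (xsubst s m t').
Proof.
move=> mM; case=> {t t'} /=.
- by move=> u v; rewrite lsub_subst; apply: X_lam.
- by move=> u v; rewrite cmu_subst //; apply: X_mu.
- by move=> h u v hM; apply/X_1/isM_subst.
- by move=> u; rewrite msub_subst; apply: X_2.
- by move=> h h' u hM hM'; apply: X_3; apply: isM_subst.
- move=> h u hM; rewrite msub_subst /=.
  have -> : xsubst (lup s) (fun a => xlshift (m a)) h = xsubst s m h.
    by case: h hM => //= a _; apply: isM_lshift.
  exact/X_4/isM_subst.
- move=> u hu; rewrite s5_subst //; apply: X_5.
  by apply: dlam_subst hu => -[].
- move=> u v o; apply: X_6.
  rewrite -xmshift_subst.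
  exact: (occ_subst (fun x => xmshift (s x)) (mup m) o).
- by move=> v k cv kC kb; rewrite cv (isC_closed kC); apply: X_push.
- by move=> k hb kC; rewrite !(isC_closed kC); apply: X_eta.
- by move=> t hb; apply: X_bot.
Qed.

Lemma xred_subst b s m t t' : (forall a, isM (m a)) ->
  xred b t t' -> xred b (xsubst s m t) (xsubst s m t').
Proof.
move=> mM h; elim: h s m mM => {t t'} /= [t t' c|u u' _ IH|u u' _ IH|u u' v _ IH|u v v' _ IH] s m mM.
- exact/xred_contract/xcontract_subst.
- by apply/xred_lam/IH => a; apply: isM_xren.
- by apply/xred_mu/IH/isM_mup.
- exact/xred_appl/IH.
- exact/xred_appr/IH.
Qed.

Lemma xreds_subst b s m t t' : (forall a, isM (m a)) ->
  xreds b t t' -> xreds b (xsubst s m t) (xsubst s m t').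
Proof.
by move=> mM; apply: xreds_map => ? ? ?; apply/xreds_step/xred_subst.
Qed.

Lemma xreds_ren b r q t t' : xreds b t t' -> xreds b (xren r q t) (xren r q t').
Proof. by rewrite !xren_subst; apply: xreds_subst. Qed.

Lemma xreds_subst_pt b s m s' m' t :
  (forall x, xreds b (s x) (s' x)) -> (forall a, xreds b (m a) (m' a)) ->
  xreds b (xsubst s m t) (xsubst s' m' t).
Proof.
elim: t s m s' m' => //= [u IH|u IH|u IHu v IHv] s m s' m' hs hm.
- by apply/xreds_lam/IH => [[|x]|a] //=; apply: xreds_ren.
- by apply/xreds_mu/IH => [x|[|a]] //=; apply: xreds_ren.
- exact: xreds_app (IHu _ _ _ _ hs hm) (IHv _ _ _ _ hs hm).
Qed.

Lemma lsub_reds b v v' u : xreds b v v' -> xreds b (lsub v u) (lsub v' u).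
Proof. by move=> h; apply: xreds_subst_pt => -[]. Qed.

Lemma msub_reds b k k' u : xreds b k k' -> xreds b (msub k u) (msub k' u).
Proof. by move=> h; apply: xreds_subst_pt => -[]. Qed.

Lemma lsub_red b v u u' : xred b u u' -> xred b (lsub v u) (lsub v u').
Proof. exact: xred_subst. Qed.

Lemma msub_red b k u u' : isM k -> xred b u u' -> xred b (msub k u) (msub k u').
Proof. by move=> kM; apply: xred_subst => -[]. Qed.

(* The constants that [xred false] treats exactly as mu-variables. *)
Definition isR (k : xterm) : bool :=
  match k with XM _ | Base _ => true | Push _ k' => ~~ isBot k' | _ => false end.

Lemma isR_isM k : isR k -> isM k. Proof. by case: k. Qed.

Lemma isR_lup (m : nat -> xterm) : (forall a, isR (m a)) -> forall a, isR (xlshift (m a)).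
Proof. by move=> mR a; move: (mR a); case: (m a). Qed.

Lemma isR_mup (m : nat -> xterm) : (forall a, isR (m a)) -> forall a, isR (mup m a).
Proof. by move=> mR [|a] //=; move: (mR a); case: (m a). Qed.

Lemma lleaf_ren r q t : lleaf t -> lleaf (xren r q t).
Proof. by case: t. Qed.

Lemma lleaf_lup (s : nat -> xterm) : (forall a, lleaf (s a)) -> forall a, lleaf (lup s a).
Proof. by move=> mR [|a] //=; apply: lleaf_ren. Qed.

Section Reflect.
Variables (s m : nat -> xterm).
Hypotheses (sl : forall x, lleaf (s x)) (mM : forall a, isM (m a)).

Lemma subst_eq_lam t u : xsubst s m t = XLam u ->
  exists2 t', t = XLam t' & u = xsubst (lup s) (fun a => xlshift (m a)) t'.
Proof.
case: t => //= [x|a|t [<-]]; last by exists t.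
  by move: (sl x); case: (s x).
by move: (mM a); case: (m a).
Qed.

Lemma subst_eq_mu t u : xsubst s m t = XMu u ->
  exists2 t', t = XMu t' & u = xsubst (fun x => xmshift (s x)) (mup m) t'.
Proof.
case: t => //= [x|a|t [<-]]; last by exists t.
  by move: (sl x); case: (s x).
by move: (mM a); case: (m a).
Qed.

Lemma subst_eq_app t u v : xsubst s m t = XApp u v ->
  exists t1 t2, [/\ t = XApp t1 t2, u = xsubst s m t1 & v = xsubst s m t2].
Proof.
case: t => //= [x|a|t1 t2 [<- <-]]; last by exists t1, t2.
  by move: (sl x); case: (s x).
by move: (mM a); case: (m a).
Qed.

Lemma subst_isM t : isM (xsubst s m t) -> isM t.
Proof. by case: t => //= x; move: (sl x); case: (s x). Qed.

End Reflect.

Lemma occ_subst_inv s m t u v : (forall x, lleaf (s x)) ->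
  (forall a, isM (m a)) -> occ (XApp u v) (xsubst s m t) ->
  exists u' v', [/\ occ (XApp u' v') t, u = xsubst s m u' & v = xsubst s m v'].
Proof.
elim: t s m u v => [x|a|t IH|t IH|t1 IH1 t2 IH2|||o|? _ ? _] s m u v sl mM /=.
- by move: (sl x); case: (s x) => //= [y||] _ o; inversion o.
- by move: (mM a); case: (m a) => //= [y|y|y z] _ o; inversion o.
- move=> o; inversion o as [|? ? o'| | |]; subst.
  case: (IH _ _ _ _ _ _ o') => [|a|u' [v' [o1 /lshift_inv [u1 ? ?] /lshift_inv [v1 ? ?]]]].
  + exact: lleaf_lup.
  + exact: isM_xren.
  by subst; exists u1, v1; split=> //; apply: occ_lam.
- move=> o; inversion o as [| |? ? o'| |]; subst.
  case: (IH _ _ _ _ _ _ o') => [x||u' [v' [o1 /mshift_inv [u1 ? ?] /mshift_inv [v1 ? ?]]]].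
  + exact: lleaf_ren.
  + exact: isM_mup.
  by subst; exists u1, v1; split=> //; apply: occ_mu.
- move=> o; inversion o as [| | |? ? ? o'|? ? ? o']; subst.
  + by exists t1, t2; split=> //; apply: occ_refl.
  + case: (IH1 _ _ _ _ sl mM o') => u' [v' [o1 ? ?]].
    by subst; exists u', v'; split=> //; apply: occ_appl.
  + case: (IH2 _ _ _ _ sl mM o') => u' [v' [o1 ? ?]].
    by subst; exists u', v'; split=> //; apply: occ_appr.
- by move=> o; inversion o.
- by move=> o; inversion o.
- by move=> o'; inversion o'.
- by move=> o'; inversion o'.
Qed.

Lemma xcontract_subst_inv s m t z : (forall x, lleaf (s x)) ->
  (forall a, isR (m a)) -> xcontract false (xsubst s m t) z ->
  exists2 t', xcontract false t t' & z = xsubst s m t'.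
Proof.
move=> sl mR; have mM a : isM (m a) by apply: isR_isM.
move=> c; inversion c as [u v e|u v e|h u v hM e|u e|h h' u hM hM' e|h u hM e|u hu e|u v o e|v k cv kC kb e|k fb|u fb] => //; subst.
- case: (subst_eq_app sl mM (esym e)) => t1 [t2 [-> e1 ->]].
  case: (subst_eq_lam sl mM (esym e1)) => u' -> ->.
  by exists (lsub t2 u'); [apply: X_lam | rewrite lsub_subst].
- case: (subst_eq_app sl mM (esym e)) => t1 [t2 [-> e1 ->]].
  case: (subst_eq_mu sl mM (esym e1)) => u' -> ->.
  eexists; first exact: X_mu.
  by rewrite /= cmu_subst.
- case: (subst_eq_app sl mM (esym e)) => t1 [t2 [-> e1 e2]].
  case: (subst_eq_app sl mM (esym e1)) => t3 [t4 [-> e3 e4]]; subst.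
  by exists (XApp t3 t4); [apply/X_1/(subst_isM sl hM) | ].
- case: (subst_eq_mu sl mM (esym e)) => u1 -> e1.
  case: (@subst_eq_mu _ _ _ _ u1 u (esym e1)).
  + by move=> x; apply: lleaf_ren.
  + exact: isM_mup.
  move=> u2 -> ->; eexists; first exact: X_2.
  by rewrite /= msub_subst.
- case: (subst_eq_app sl mM (esym e)) => t1 [t2 [-> e1 e2]].
  case: (subst_eq_app sl mM (esym e2)) => t3 [t4 [-> e3 e4]]; subst.
  exists (XApp t3 t4) => //; apply: X_3.
    exact: (subst_isM sl hM).
  exact: (subst_isM sl hM').
- case: (subst_eq_app sl mM (esym e)) => t1 [t2 [-> e1 e2]].
  case: (subst_eq_mu sl mM (esym e2)) => t3 -> e3; subst.
  have hM' := subst_isM sl hM.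
  eexists; first exact: X_4.
  rewrite msub_subst /=; do 3 f_equal.
  by clear -hM' mM; case: t1 hM' => //= a _; rewrite isM_lshift.
- case: (subst_eq_mu sl mM (esym e)) => u1 -> e1; subst.
  exists (XLam (XMu (xsubst (fun x => XL x.+1)
    (scons (XLam (XApp (XM 0) (XApp (XL 0) (XL 1)))) (fun a => XM a.+1)) u1))).
    apply: X_5; apply: (dlam_subst_inv _ _ _ hu) => [x||[|a]] //=.
    + exact: lleaf_ren.
    + exact: isM_mup.
    + by move: (mR a); case: (m a).
  by rewrite /= s5_subst.
- case: (subst_eq_mu sl mM (esym e)) => u1 -> e1; subst.
  case: (occ_subst_inv _ _ o) => [x||u' [v' [o1 e1 /mshift_inv [v1 ? ?]]]].
  + exact: lleaf_ren.
  + exact: isM_mup.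
  subst; exists v1 => //; apply: X_6.
  case: u' o1 e1 => //= [x _|[|a] //]; first by move: (sl x); case: (s x).
  by move=> _; move: (mR a) => /=; case: (m a).
- case: t c e => //= [x|a|v0 k0].
  + by move: (sl x); case: (s x).
  + move: (mR a); case: (m a) => // v0 k0 /= + _ [_ ek].
    by move: kb => /=; rewrite -ek => ->.
  move=> _ [<- <-]; exists (XLam (XApp k (XApp (XL 0) v))).
    exact: X_push.
  by rewrite /= cv (isC_closed kC).
Qed.

Lemma xred_subst_inv s m t z : (forall x, lleaf (s x)) ->
  (forall a, isR (m a)) -> xred false (xsubst s m t) z ->
  exists2 t', xred false t t' & z = xsubst s m t'.
Proof.
elim: t s m z => [x|a|t IH|t IH|t1 IH1 t2 IH2|||o|v _ k _] s m z sl mR h;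
  (inversion h as [? ? c|u u' h' e|u u' h' e|u u' v' h' e|u v0 v' h' e]; subst;
  first by case: (xcontract_subst_inv sl mR c) => t' c' ->; exists t' => //;
    apply: xred_contract).
all: try by move: (sl x); rewrite /= in e; rewrite -e.
all: try by move: (mR a); rewrite /= in e; rewrite -e.
- case: (IH _ _ _ _ _ h') => [||t' ht ->].
  + exact: lleaf_lup.
  + exact: isR_lup.
  by exists (XLam t') => //; apply: xred_lam.
- case: (IH _ _ _ _ _ h') => [x||t' ht ->].
  + exact: lleaf_ren.
  + exact: isR_mup.
  by exists (XMu t') => //; apply: xred_mu.
- by case: (IH1 _ _ _ sl mR h') => t' ht ->; exists (XApp t' t2) => //; apply: xred_appl.
- by case: (IH2 _ _ _ sl mR h') => t' ht ->; exists (XApp t1 t') => //; apply: xred_appr.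
Qed.

Lemma xreds_subst_inv s m t z : (forall x, lleaf (s x)) ->
  (forall a, isR (m a)) -> xreds false (xsubst s m t) z ->
  exists2 t', xreds false t t' & z = xsubst s m t'.
Proof.
move=> sl mR; move e : (xsubst s m t) => u h; elim: h t e => {u z} [u z h|u|u v z _ IH1 _ IH2] t e.
- rewrite -e in h; case: (xred_subst_inv sl mR h) => t' h' ->; exists t' => //; exact: xreds_step.
- by exists t.
- case: (IH1 _ e) => t1 h1 e1; case: (IH2 _ (esym e1)) => t2 h2 ->.
  by exists t2 => //; apply: xreds_trans h1 h2.
Qed.

Definition xnum (n : nat) : xterm := iter n (XApp Next) Zero.

(** * Observations *)

(* Up to one step of [S5] or [S6] under an enclosing binder of the head, an
   answer exhibits a value of the type of that head. *)
Variant answer (t : xterm) : Prop :=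
  | answer_lam of dlam xpred0 isPushN t
  | answer_num n of occ (XApp (Base (Some n)) (xnum n)) t
  | answer_next k of isPushN k & occ (XApp k Next) t.

Definition answers (t : xterm) : Prop := exists2 t', xreds false t t' & answer t'.

Definition value_at (k t : xterm) : Prop :=
  match k with
  | Base (Some n) => xreds false t (xnum n)
  | Push _ k' =>
    isBot k' \/ (exists u, xreds false t (XLam u)) \/ xreds false t Next
  | _ => False
  end.

Definition progress (k t : xterm) : Prop := value_at k t \/ answers t.

Lemma answers_exp t u : xreds false t u -> answers u -> answers t.
Proof. by move=> h [v huv a]; exists v => //; apply: xreds_trans h huv. Qed.

Lemma progress_exp k t u : xreds false t u -> progress k u -> progress k t.
Proof.
move=> h [] p; last by right; apply: answers_exp p.
left; case: k p => //= [[n|//]|_ k]; first exact: xreds_trans.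
case=> [->|[[v hv]|hv]]; first by left.
  by right; left; exists v; apply: xreds_trans hv.
by right; right; apply: xreds_trans hv.
Qed.

Lemma answer_appr t u : answer t -> answer (XApp u t).
Proof.
case=> [h|n h|k hk h].
- by apply: answer_lam; rewrite /= h !orbT.
- by apply: (@answer_num _ n); apply: occ_appr.
- by apply: (@answer_next _ k); last apply: occ_appr.
Qed.

Lemma answers_appr t u : answers t -> answers (XApp u t).
Proof.
by case=> t' h a; exists (XApp u t'); [apply: xreds_appr | apply: answer_appr].
Qed.

(* [S2] turns mu alpha (mu beta u) into mu alpha u[beta := id], hence [lred_mu]:
   a term of type bot of the form mu beta u remains of type bot when beta is
   instantiated. [lred_occ] is what makes [S6] sound. *)
Inductive lred : xterm -> xterm -> Prop :=
  | lred_red t t' : xred true t t' -> lred t t'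
  | lred_mu u : lred (XMu u) (msub (Base None) u)
  | lred_occ k u t : isC k -> occ (XApp k u) t -> lred t (XApp k u).

Record local (t : xterm) : Prop := Local {
  local_clean : clean t;
  local_lam : ~~ isLam t;
  local_answers : answers t;
  local_progress : forall k u, isC k -> t = XApp k u -> progress k u }.

Definition ok (t : xterm) : Prop :=
  forall t', clos_refl_trans _ lred t t' -> local t'.

Lemma ok_local t : ok t -> local t.
Proof. by move=> h; apply/h/rt_refl. Qed.

Lemma ok_lred t t' : ok t -> lred t t' -> ok t'.
Proof.
by move=> h l u hu; apply: h; apply: rt_trans hu; apply: rt_step.
Qed.

Lemma ok_reds t t' : ok t -> xreds true t t' -> ok t'.
Proof.
move=> h hr; elim: hr h => {t t'} [t t' h|//|t u v _ IH1 _ IH2 /IH1/IH2 //].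
by move=> /ok_lred; apply; apply: lred_red.
Qed.

Lemma ok_coind (Z : xterm -> Prop) :
  (forall t, Z t -> local t) ->
  (forall t t', Z t -> lred t t' -> Z t' \/ ok t') ->
  forall t, Z t -> ok t.
Proof.
move=> hl hs t zt t' h.
have : Z t' \/ ok t'.
  elim: (clos_rt_rtn1 _ _ _ _ h) => {t' h} [|t1 t2 h _ []]; first by left.
    by move=> z1; apply: hs h.
  by move=> o1; right; apply: ok_lred h.
by case=> [/hl|/ok_local].
Qed.

Record lcv (t : xterm) : Prop := Lcv {
  lcv_clean : clean t;
  lcv_occ : forall k u, isC k -> occ (XApp k u) t -> ok (XApp k u) }.

Definition okv (t : xterm) : Prop := forall t', xreds true t t' -> lcv t'.

Lemma okv_lcv t : okv t -> lcv t.
Proof. by apply. Qed.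

Lemma okv_reds t t' : okv t -> xreds true t t' -> okv t'.
Proof. by move=> h hr u hu; apply: h; apply: xreds_trans hu. Qed.

Lemma ok_lcv t : ok t -> lcv t.
Proof.
move=> h; split; first by case: (ok_local h).
by move=> k u kC o; apply: (ok_lred h); apply: lred_occ.
Qed.

Lemma ok_okv t : ok t -> okv t.
Proof. by move=> h t' hr; apply/ok_lcv/(ok_reds h). Qed.

Lemma clean_app t u : clean (XApp t u) -> clean t /\ clean u.
Proof. by rewrite /clean /= !negb_or => /and3P [_ -> ->]. Qed.

Lemma lcv_app t u : lcv (XApp t u) -> lcv t /\ lcv u.
Proof.
case=> /clean_app [ct cu] h; split; split=> // k v kC o; apply: h => //.
  exact: occ_appl.
exact: occ_appr.
Qed.

Lemma okv_appr t u : okv (XApp t u) -> okv u.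
Proof.
by move=> h u' hu; have /lcv_app [] := h _ (xreds_appr t hu).
Qed.

Inductive good : xterm -> Prop :=
  | good_base o : good (Base o)
  | good_push v k : closed v -> okv v -> good k -> good (Push v k).

Lemma good_isC k : good k -> isC k. Proof. by case. Qed.

Lemma good_closed k : good k -> closed k.
Proof. by move=> /good_isC/isC_closed. Qed.

(* The shapes [z] taken by [XApp k t] when only [k] and its arguments are
   reduced; [frame_naked] is the result of [X_bot]. *)
Inductive frame : xterm -> xterm -> xterm -> Prop :=
  | frame_const k t : frame k t (XApp k t)
  | frame_push v v' k t z :
      xreds true v v' -> frame k (XApp t v') z -> frame (Push v k) t z
  | frame_naked t : frame (Base None) t t
  | frame_lam k t b : frame k (XL 0) b -> frame k t (XApp (XLam b) t).

Lemma frame_subst k t z s m : good k -> (forall a, isM (m a)) ->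
  frame k t z -> frame k (xsubst s m t) (xsubst s m z).
Proof.
move=> gk mM f; elim: f s m mM gk => {k t z} [k t|v v' k t z hv f IH|t|k t b f IH] s m mM gk /=.
- by rewrite (good_closed gk); apply: frame_const.
- inversion gk as [|? ? cv _ gk']; subst.
  apply: (@frame_push _ (xsubst s m v')); last exact: (IH s m).
  by rewrite -{1}(cv s m); apply: xreds_subst.
- exact: frame_naked.
- by apply: frame_lam; apply: IH => // a; apply: isM_xren.
Qed.

Lemma xreds_push b v k t : good (Push v k) -> b || isBot k ->
  xreds b (XApp (Push v k) t) (XApp k (XApp t v)).
Proof.
move=> gk hb; inversion gk as [|? ? cv _ gk']; subst.
apply: xreds_trans (xreds_appl _ (xreds_contract (X_push cv (good_isC gk') hb))) _.
apply: xreds_trans (xreds_contract (X_lam _ _ _)) _.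
by rewrite /lsub /= cv (good_closed gk').
Qed.

Lemma frame_reds k t z : good k -> frame k t z -> xreds true (XApp k t) z.
Proof.
move=> gk f; elim: f gk => {k t z} [k t|v v' k t z hv f IH|t|k t b f IH] gk.
- exact: xreds_refl.
- apply: xreds_trans (xreds_push _ gk _) _ => //.
  inversion gk; subst; apply: xreds_trans (IH _) => //.
  exact/xreds_appr/xreds_appr.
- exact/xreds_contract/X_bot.
- apply: xreds_trans (xreds_appl _ (xreds_contract (X_eta _ (good_isC gk)))) _ => //.
  exact/xreds_appl/xreds_lam/IH.
Qed.

Lemma frame_ok k t z : good k -> ok (XApp k t) -> frame k t z -> ok z.
Proof. by move=> gk h f; apply: ok_reds (frame_reds gk f). Qed.

Definition slcv (v : xterm) : Prop :=
  forall s m, (forall a, isM (m a)) -> lcv (xsubst s m v).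

Lemma slcv_lcv v : slcv v -> lcv v.
Proof. by move=> h; rewrite -(xsubst_id v); apply: h. Qed.

Lemma slcv_reds v v' : closed v -> okv v -> xreds true v v' -> slcv v'.
Proof. by move=> cv ov hv s m mM; apply: ov; rewrite -(cv s m); apply: xreds_subst. Qed.

Inductive vspine (x : nat) : xterm -> Prop :=
  | vspine_var : vspine x (XL x)
  | vspine_app t v : vspine x t -> slcv v -> vspine x (XApp t v).

Lemma vspine_lfr x t : vspine x t -> lfr x t.
Proof. by elim=> //= ? ? _ ->. Qed.

Lemma vspine_appM x h u : isM h -> ~ vspine x (XApp h u).
Proof. by move=> hM n; inversion n as [|? ? n']; subst; case: n' hM. Qed.

Lemma vspine_head x t v b t' : vspine x t -> ~ xcontract b (XApp t v) t'.
Proof.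
move=> n c; inversion c as [| |? ? ? hM| |? ? ? hM|? ? hM| | | | |]; subst;
  try (by inversion n); first by case: (vspine_appM hM n).
  by case: n hM.
by case: n hM.
Qed.

Lemma xred_L b x t : ~ xred b (XL x) t.
Proof. by move=> h; inversion h as [? ? c| | | |]; subst; inversion c. Qed.

Lemma frame_vstep k x t z z' : good k -> vspine x t -> frame k t z ->
  xred true z z' ->
  frame k t z' \/ exists2 t', xred true t t' & frame k t' z'.
Proof.
move=> gk n f; elim: f x gk n z' => {k t z} [k t|v v' k t z hv f IH|t|k t b f IH] x gk n z' h.
- have kC := good_isC gk.
  inversion h as [? ? c| | |u u' w hu e|u w w' hw]; subst.
  + inversion c as [| |? ? ? hM| |? ? ? hM hM'|? ? hM| | | | |]; subst;
      try (by inversion n); try by [].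
    * by case: (vspine_appM hM' n).
    * by left; apply: frame_naked.
  + left; inversion hu as [? ? c| | | |]; subst => //.
    inversion c; subst => //.
      by inversion gk; subst; apply: frame_lam; apply: frame_push (xreds_refl _ _) (frame_const _ _).
    exact: frame_lam (frame_const _ _).
  + by right; exists w' => //; apply: frame_const.
- inversion gk as [|? ? cv ov gk']; subst.
  have n' : vspine x (XApp t v') by apply: vspine_app => //; apply: slcv_reds hv.
  case: (IH _ gk' n' _ h) => [f'|[t' ht f']]; first by left; apply: frame_push f'.
  inversion ht as [? ? c| | |u u' w hu e|u w w' hw]; subst.
  + by case: (vspine_head n c).
  + by right; exists u' => //; apply: frame_push f'.
  + by left; apply: frame_push f' => //; apply: xreds_trans hv (xreds_step hw).
- by right; exists z' => //; apply: frame_naked.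
- inversion h as [? ? c| | |u u' w hu e|u w w' hw]; subst.
  + inversion c; subst => //; left.
    by apply: (frame_subst (scons t XL) gk _ f).
  + inversion hu as [? ? c|v v' hv e| | |]; subst; first by inversion c.
    left; case: (IH 0 gk (vspine_var 0) _ hv) => [f'|[t' /xred_L //]].
    exact: frame_lam.
  + by right; exists w' => //; apply: frame_lam.
Qed.

Lemma vspine_clean x t : vspine x t -> clean t.
Proof.
elim=> //= {}t v n + /slcv_lcv [cv _].
rewrite /clean /= !negb_or => -> /=; rewrite andbC -/(clean v) cv /=.
by case: v {cv} => //; case: n.
Qed.

Lemma vspine_occ x t k u s m : vspine x t -> isC k -> (forall a, isM (m a)) ->
  occ (XApp k u) t -> ok (xsubst s m (XApp k u)).
Proof.
move=> n kC mM; elim: n => [|t' v n' IH hv] o; inversion o; subst => //.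
- by inversion n'; subst.
- exact: IH.
- have [_ h] := hv s m mM; rewrite /= (isC_closed kC); apply: h => //.
  by have := occ_subst s m H1; rewrite /= (isC_closed kC).
Qed.

Lemma frame_vclean k x t z : good k -> vspine x t -> frame k t z -> clean z.
Proof.
move=> gk n f; elim: f x gk n => {k t z} [k t|v v' k t z hv f IH|t|k t b f IH] x gk n.
- have := vspine_clean n; rewrite /clean /= !negb_or => ->; case: gk => //= *.
    by case: n.
  by case: n.
- inversion gk as [|? ? cv ov gk']; subst; apply: (IH x) => //.
  by apply: vspine_app => //; apply: slcv_reds hv.
- exact: vspine_clean n.
- have := IH _ gk (vspine_var 0); have := vspine_clean n.
  by rewrite /clean /= !negb_or => -> ->; case: n.
Qed.

Lemma isC_occ k c u : isC k -> ~ occ (XApp c u) k.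
Proof. by case: k => // [o|v k] _ h; inversion h. Qed.

Lemma frame_vocc k x t z c u s m : good k -> vspine x t -> frame k t z ->
  isC c -> (forall a, isM (m a)) ->
  ~~ lfr x (XApp c u) -> occ (XApp c u) z -> ok (xsubst s m (XApp c u)).
Proof.
move=> gk n f; elim: f x gk n c u s m => {k t z} [k t|v v' k t z hv f IH|t|k t b f IH] x gk n c u s m cC mM.
- move=> nf o; inversion o as [| | |? ? ? o'|? ? ? o']; subst.
  + by move: nf; rewrite /= (vspine_lfr n) orbT.
  + by case: (isC_occ (good_isC gk) o').
  + exact: vspine_occ n cC mM o'.
- inversion gk as [|? ? cv ov gk']; subst.
  by apply: (IH x) => //; apply: vspine_app => //; apply: slcv_reds hv.
- by move=> _; apply: vspine_occ n cC mM.
- move=> nf o; inversion o as [| | |? ? ? o' |? ? ? o']; subst => //.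
    inversion o' as [|? ? o''| | |]; subst.
    have cE r q : xren r q c = c by rewrite closed_ren //; apply: isC_closed.
    rewrite /= cE in o''.
    have := IH 0 gk (vspine_var 0) c _ (scons Zero s) m cC mM _ o''.
    rewrite /= xsubst_xren !(isC_closed cC); apply.
    by rewrite /= (negbTE (lfr_lshift u)) orbF; case: (c) cC.
  exact: vspine_occ n cC mM o'.
Qed.

(** * Coinduction *)

Section Coinduction.
Variable R : xterm -> xterm -> Prop.

Record stable (k t : xterm) : Prop := Stable {
  stable_red : forall t', xred true t t' -> R k t';
  stable_push : forall v k' v', k = Push v k' -> xreds true v v' ->
    R k' (XApp t v');
  stable_lcv : lcv t;
  stable_progress : progress k t;
  stable_lam : isBase k -> ~~ isLam t;
  stable_mu : forall u, t = XMu u -> ok (msub k u);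
  stable_head : forall h u, isM h -> t = XApp h u -> k = Base None }.

Hypothesis hR : forall k t, R k t -> good k /\ (ok (XApp k t) \/ stable k t).

Lemma R_answers k t : good k -> R k t -> answers (XApp k t).
Proof.
move=> gk; elim: gk t => {k} [o|v k cv ov gk IH] t h; case: (hR h) => g [oh|sh].
- by case: (ok_local oh).
- have [p|] := stable_progress sh; last exact: answers_appr.
  case: o p {h g sh} => //= n p.
  by exists (XApp (Base (Some n)) (xnum n)); [apply: xreds_appr | apply/answer_num/occ_refl].
- by case: (ok_local oh).
- case e : (isBot k).
    apply: answers_exp (xreds_push _ g _) (IH _ _); first by rewrite e.
    exact: (stable_push sh).
  have [[|[[u hu]|hn]]|] := stable_progress sh; last exact: answers_appr.
  + by rewrite e.
  + exists (XApp (Push v k) (XLam u)); first exact: xreds_appr.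
    by apply: answer_lam; rewrite /= e.
  + exists (XApp (Push v k) Next); first exact: xreds_appr.
    by apply: (@answer_next _ (Push v k)); [rewrite /= e | apply: occ_refl].
Qed.

Lemma frame_answers k t z s m : (forall a, isM (m a)) -> frame k t z ->
  R k (xsubst s m t) -> answers (xsubst s m z).
Proof.
move=> mM f; elim: f s m mM => {k t z} [k t|v v' k t z hv f IH|t|k t b f IH] s m mM h;
  case: (hR h) => gk [oh|sh].
- by rewrite /= (good_closed gk); apply: R_answers.
- by rewrite /= (good_closed gk); apply: R_answers.
- have f' := frame_push hv f; have {}f' := frame_subst s gk mM f'.
  exact: (local_answers (ok_local (frame_ok gk oh f'))).
- inversion gk as [|? ? cv ov gk']; subst; apply: IH => //=.
  by apply: (stable_push sh erefl); rewrite -(cv s m); apply: xreds_subst.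
- exact: (local_answers (ok_local (frame_ok gk oh (frame_naked _)))).
- by have [//|] := stable_progress sh.
- have f' := frame_subst s gk mM (frame_lam t f).
  exact: (local_answers (ok_local (frame_ok gk oh f'))).
- have := IH (scons (xsubst s m t) s) m mM h.
  apply: answers_exp; apply: xreds_trans (xreds_contract (X_lam _ _ _)) _.
  rewrite /lsub xsubst_xsubst.
  rewrite (@xsubst_ext _ _ (scons (xsubst s m t) s) m) // => [[|x]|a] //=.
    exact: lsub_lshift.
  exact: lsub_lshift.
Qed.

Lemma frame_lstep k t z z' : R k t -> frame k t z -> lred z z' ->
  (exists k' t', R k' t' /\ frame k' t' z') \/ ok z'.
Proof.
move=> h f; elim: f h z' => {k t z} [k t|v v' k t z hv f IH|t|k t b f IH] h z' l;
  case: (hR h) => gk [oh|sh].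
- by right; apply: ok_lred l.
- have kC := good_isC gk.
  inversion l as [? ? r| |c u ? cC o]; subst; last first.
    inversion o as [| | |? ? ? o'|? ? ? o']; subst.
    + by left; exists k, t; split=> //; apply: frame_const.
    + by case: (isC_occ kC o').
    + by right; apply: (lcv_occ (stable_lcv sh) cC o').
  inversion r as [? ? c| | |u u' w hu e|u w w' hw]; subst.
  + inversion c as [| |? ? ? hM| |? ? ? hM hM'|? u hM| | | | |]; subst => //.
    * have e := stable_head sh hM' erefl; subst.
      by left; exists (Base None), (XApp h' u); split=> //; apply: frame_naked.
    * right; apply: ok_reds (stable_mu sh erefl) _.
      exact/msub_reds/xreds_contract/X_eta.
    * by left; exists (Base None), z'; split=> //; apply: frame_naked.
  + left; exists k, t; split=> //.
    inversion hu as [? ? c| | | |]; subst => //.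
    inversion c; subst => //.
      by inversion gk; subst; apply/frame_lam/(frame_push (xreds_refl _ _))/frame_const.
    exact/frame_lam/frame_const.
  + by left; exists k, w'; split; [apply: (stable_red sh) | apply: frame_const].
- right; apply: ok_lred l; apply: frame_ok gk oh _; exact: frame_push f.
- exact: (IH (stable_push sh erefl hv)).
- right; apply: ok_lred l; apply: frame_ok gk oh _; exact: frame_naked.
- inversion l as [? ? r|u e|c u ? cC o]; subst.
  + left; exists (Base None), z'; split; first exact: (stable_red sh).
    exact: frame_naked.
  + by right; apply: (stable_mu sh).
  + by right; apply: (lcv_occ (stable_lcv sh) cC o).
- right; apply: ok_lred l; apply: frame_ok gk oh _; exact: frame_lam.
- inversion l as [? ? r| |c u ? cC o]; subst; last first.
    right; inversion o as [| | |? ? ? o'|? ? ? o']; subst => //.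
    + inversion o' as [|? ? o''| | |]; subst.
      have cE r q : xren r q c = c by rewrite closed_ren //; apply: isC_closed.
      rewrite /= cE in o''.
      have := frame_vocc (s := scons Zero XL) (m := XM) gk (vspine_var 0) f cC _ _ o''.
      rewrite /= (isC_closed cC) -/(lsub _ _) lsub_lshift; apply=> //.
      by rewrite /= (negbTE (lfr_lshift u)) orbF; case: (c) cC.
    + exact: (lcv_occ (stable_lcv sh) cC o').
  inversion r as [? ? c| | |u u' w hu e|u w w' hw]; subst.
  + inversion c; subst => //; left; exists k, t; split=> //.
    by apply: (frame_subst (scons t XL) gk _ f).
  + left; exists k, t; split=> //.
    inversion hu as [? ? c|? v' hv e| | |]; subst; first by inversion c.
    case: (frame_vstep gk (vspine_var 0) f hv) => [f'|[t' /xred_L //]].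
    exact: frame_lam.
  + by left; exists k, w'; split; [apply: (stable_red sh) | apply: frame_lam].
Qed.

Lemma frame_local k t z : R k t -> frame k t z -> local z.
Proof.
move=> h f; elim: f h => {k t z} [k t|v v' k t z hv f IH|t|k t b f IH] h;
  case: (hR h) => gk [oh|sh].
- exact: ok_local.
- have [ct _] := stable_lcv sh; split=> //.
  + move: ct; rewrite /clean /= !negb_or => ->.
    have := stable_lam sh; case: gk => //= o; last by case: (t).
    by case: (t) => //= ? /(_ isT).
  + exact: R_answers.
  + by move=> c u _ [<- <-]; apply: stable_progress sh.
- apply: ok_local; apply: frame_ok gk oh _; exact: frame_push f.
- exact: (IH (stable_push sh erefl hv)).
- apply: ok_local; apply: frame_ok gk oh _; exact: frame_naked.
- have [ct co] := stable_lcv sh; split=> //.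
  + exact: (stable_lam sh).
  + by case: (stable_progress sh).
  + move=> c u cC e; have := co c u cC; rewrite -e => /(_ (occ_refl _)) /ok_local lt.
    exact: (local_progress lt cC e).
- apply: ok_local; apply: frame_ok gk oh _; exact: frame_lam.
- split=> //.
  + have [ct _] := stable_lcv sh; have := frame_vclean gk (vspine_var 0) f.
    by move: ct; rewrite /clean /= !negb_or => -> ->; case: (t).
  + have := frame_answers (s := XL) (m := XM) (fun=> isT) (frame_lam t f).
    by rewrite !xsubst_id; apply.
  + by move=> c u cC [e _]; rewrite -e in cC.
Qed.

Lemma coind_ok k t : R k t -> ok (XApp k t).
Proof.
move=> h; apply: (ok_coind (Z := fun z => exists k' t', R k' t' /\ frame k' t' z)).
- move=> z [k' [t' [h' f]]]; exact: frame_local h' f.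
- move=> z z' [k' [t' [h' f]]] l; exact: frame_lstep h' f l.
- by exists k, t; split=> //; apply: frame_const.
Qed.
End Coinduction.

Lemma ok_bot t : ok t -> ok (XApp (Base None) t).
Proof.
move=> ot; pose R k t := k = Base None /\ ok t.
apply: (coind_ok (R := R)) => // k {ot}t [-> ot]; split; first exact: good_base.
right; split=> //.
- by move=> t' r; split=> //; apply: ok_lred ot _; apply: lred_red.
- exact: ok_lcv.
- by right; apply/local_answers/ok_local.
- by move=> _; apply/local_lam/ok_local.
- by move=> u e; rewrite e in ot; apply: (ok_lred ot); apply: lred_mu.
Qed.

Lemma xred_leaf b t t' : xred b t t' -> match t with Zero | Next | Base _ => b /\ isC t | _ => True end.
Proof.
move=> h; inversion h as [? ? c| | | |]; subst => //.
by inversion c; subst => //; case: (t) H0.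
Qed.

Lemma ok_zero : ok (XApp (Base (Some 0)) Zero).
Proof.
pose R k t := k = Base (Some 0) /\ t = Zero.
apply: (coind_ok (R := R)) => // k t [-> ->]; split; first exact: good_base.
right; split=> //.
- by move=> t' /xred_leaf [].
- by split=> // k' u _ o; inversion o.
- by left; apply: xreds_refl.
Qed.

Lemma ok_const k v : good k -> closed v -> okv v -> ok (XApp k v) ->
  ok (XApp (Push v (Base None)) k).
Proof.
move=> gk cv ov h; have gv : good (Push v (Base None)) by apply: good_push => //; apply: good_base.
have kC := good_isC gk.
pose R k0 t := good k0 /\ ok (XApp k0 t) \/
  k0 = Push v (Base None) /\ (t = k \/ exists2 b, t = XLam b & frame k (XL 0) b).
apply: (coind_ok (R := R)); last by right; split=> //; left.
move=> k0 t [[g o]|[-> ht]]; first by split; [|left].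
have lam_reds b : frame k (XL 0) b -> xreds true k (XLam b).
  move=> f; apply: xreds_trans (xreds_contract (X_eta _ kC)) _ => //.
  exact/xreds_lam/(frame_reds gk).
split=> //; right; split=> //.
- move=> t' r; right; split=> //; right; case: ht => [e|[b e f]]; subst.
    inversion r as [? ? c| | | |]; subst => //; inversion c; subst => //.
      eexists; first by [].
      inversion gk; subst.
      exact: frame_push (xreds_refl _ _) (frame_const _ _).
    by exists (XApp k (XL 0)) => //; apply: frame_const.
  inversion r as [? ? c|? b' hb| | |]; subst; first by inversion c.
  exists b' => //.
  by case: (frame_vstep gk (vspine_var 0) f hb) => // -[t' /xred_L].
- move=> ? ? v' [<- <-] hv; left; split; first exact: good_base.
  apply: ok_bot; apply: (ok_reds h); apply: xreds_app => //.
  by case: ht => [->|[b -> /lam_reds]].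
- case: ht => [->|[b -> f]].
    by split; [case: (k) kC | move=> c u cC /(isC_occ kC)].
  split; first exact: (frame_vclean gk (vspine_var 0) f).
  move=> c u cC o; inversion o as [|? ? o''| | |]; subst.
  have cE r q : xren r q c = c by rewrite closed_ren //; apply: isC_closed.
  rewrite /= cE in o''.
  have := frame_vocc (s := scons Zero XL) (m := XM) gk (vspine_var 0) f cC _ _ o''.
  rewrite /= (isC_closed cC) -/(lsub _ _) lsub_lshift; apply=> //.
  by rewrite /= (negbTE (lfr_lshift u)) orbF; case: (c) cC.
- by left; left.
- by case: ht => [e|[b -> f]] u // eu; rewrite -e eu in kC.
- by case: ht => [e|[b -> f]] h' u // _ eu; rewrite -e eu in kC.
Qed.

Lemma ok_next v o : closed v -> okv v ->
  (forall w, xreds true v w -> progress (Base o) (XApp Next w)) ->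
  ok (XApp (Push v (Base o)) Next).
Proof.
move=> cv ov h.
pose R k t := k = Push v (Base o) /\ t = Next \/
  k = Base o /\ exists2 w, xreds true v w & t = XApp Next w.
apply: (coind_ok (R := R)); last by left.
move=> ? ?.
case=> [[-> ->]|[-> [w hw ->]]]; (split; last (right; split=> //)).
- by apply: good_push => //; apply: good_base.
- by move=> t' /xred_leaf [].
- by move=> ? ? w [<- <-] hw; right; split=> //; exists w.
- by split=> // k' u _ o'; inversion o'.
- by left; right; right; apply: xreds_refl.
- exact: good_base.
- move=> t' r; right; split=> //; inversion r as [? ? c| | |? u' ? hu|? ? w' hu]; subst.
  + by inversion c; subst.
  + by move/xred_leaf: hu => [].
  + by exists w' => //; apply: xreds_trans hw (xreds_step hu).
- have [cw ow] := ov _ hw; split; first by move: cw; rewrite /clean /= !negb_or => ->; case: (w).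
  move=> k u kC o'; inversion o' as [| | |? ? ? o''|? ? ? o'']; subst => //.
    by inversion o''.
  exact: ow o''.
- exact: h.
- by move=> h' u hM [e _]; rewrite -e in hM.
Qed.

Notation apps t ws := (foldl XApp t ws).
Notation pushes ws k := (foldr Push k ws).

(* An invariant for [coind_ok]. In [exp_lam] and [exp_push] the premise ranges
   over all reducts of the argument, so that a step of the argument, which is
   duplicated by the contraction, does not leave the invariant. *)
Inductive head_exp : xterm -> xterm -> Prop :=
  | exp_ok k t : good k -> ok (XApp k t) -> head_exp k t
  | exp_mu k u ws ws' :
      good (pushes ws k) -> List.Forall2 (xreds true) ws ws' ->
      ok (msub (pushes ws k) u) -> head_exp k (apps (XMu u) ws')
  | exp_lam k r w ws :
      okv w -> (forall w', xreds true w w' -> head_exp k (apps (lsub w' r) ws)) ->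
      head_exp k (apps (XApp (XLam r) w) ws)
  | exp_push v k r : good (Push v k) ->
      (forall v', xreds true v v' -> head_exp k (lsub v' r)) ->
      head_exp (Push v k) (XLam r).

Definition xred1 (ws ws' : seq xterm) : Prop :=
  exists ws1 w w' ws2, [/\ ws = ws1 ++ w :: ws2, ws' = ws1 ++ w' :: ws2 & xred true w w'].

Lemma apps_rcons t ws w : apps t (rcons ws w) = XApp (apps t ws) w.
Proof. by rewrite -cats1 foldl_cat. Qed.

Lemma apps_app t ws : ws <> [::] -> exists u v, apps t ws = XApp u v.
Proof. by case/lastP: ws => // ws w _; rewrite apps_rcons; exists (apps t ws), w. Qed.

Lemma isM_apps t ws : ~~ isM t -> ~~ isM (apps t ws).
Proof. by case/lastP: ws => // ws w _; rewrite apps_rcons. Qed.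

Lemma isLam_apps t ws : ~~ isLam t -> ~~ isLam (apps t ws).
Proof. by case/lastP: ws => // ws w _; rewrite apps_rcons. Qed.

Lemma spine_red t ws z : ~~ isM t -> (forall h u, isM h -> t <> XApp h u) ->
  xred true (apps t ws) z ->
  [\/ exists2 t', xred true t t' & z = apps t' ws,
      exists2 ws', xred1 ws ws' & z = apps t ws' |
      exists w ws' t', [/\ ws = w :: ws', xcontract true (XApp t w) t' & z = apps t' ws']].
Proof.
move=> tM tA; elim/last_ind: ws z => [|ws w IH] z /=.
  by move=> h; apply: Or31; exists z.
rewrite apps_rcons => h; inversion h as [? ? c| | |u u' v hu|u v v' hv]; subst.
- case/lastP: ws IH c h => [|ws w'] IH c h.
    by apply: Or33; exists w, [::], z.
  rewrite apps_rcons in c; inversion c as [| |? ? ? hM| | | | | | | |]; subst => //.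
  move: (isM_apps ws tM); case: ws {IH c h} hM => [|w0 ws] hM; last by rewrite hM.
  by case/negP.
- case: (IH _ hu) => [[t' ht ->]|[ws' [ws1 [w1 [w2 [ws2 [-> -> hw]]]]] ->]|[w1 [ws1 [t' [-> c ->]]]]].
  + by apply: Or31; exists t' => //; rewrite apps_rcons.
  + apply: Or32; exists (rcons (ws1 ++ w2 :: ws2) w); last by rewrite apps_rcons.
    by exists ws1, w1, w2, (rcons ws2 w); rewrite !rcons_cat.
  + by apply: Or33; exists w1, (rcons ws1 w), t'; rewrite apps_rcons.
- apply: Or32; exists (rcons ws v'); last by rewrite apps_rcons.
  by exists ws, w, v', [::]; rewrite !cats1.
Qed.

Lemma xred_apps b t t' ws : xred b t t' -> xred b (apps t ws) (apps t' ws).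
Proof. by elim: ws t t' => //= w ws IH t t' h; apply/IH/xred_appl. Qed.

Lemma xreds_apps b t t' ws : xreds b t t' -> xreds b (apps t ws) (apps t' ws).
Proof.
by apply: (xreds_map (f := fun t => apps t ws)) => ? ? ?; apply/xreds_step/xred_apps.
Qed.

Lemma xred_args t ws ws' : xred1 ws ws' -> xred true (apps t ws) (apps t ws').
Proof.
case=> [ws1 [w [w' [ws2 [-> -> h]]]]].
by rewrite !foldl_cat /=; apply/xred_apps/xred_appr.
Qed.

Lemma Forall2_xred1 ws0 ws ws' : List.Forall2 (xreds true) ws0 ws ->
  xred1 ws ws' -> List.Forall2 (xreds true) ws0 ws'.
Proof.
move=> h [ws1 [w [w' [ws2 [e -> hw]]]]]; rewrite {}e in h.
elim: ws1 ws0 h => [|w1 ws1 IH] ws0 h; inversion h; subst; constructor => //.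
  by apply: xreds_trans (xreds_step hw).
exact: IH.
Qed.

Lemma good_pushes ws k : good (pushes ws k) -> good k.
Proof. by elim: ws => //= w ws IH g; inversion g; subst; apply: IH. Qed.

Lemma pushes_reds ws ws' k t : good (pushes ws k) ->
  List.Forall2 (xreds true) ws ws' ->
  xreds true (XApp (pushes ws k) t) (XApp k (apps t ws')).
Proof.
move=> g h; elim: h t g => {ws ws'} [|w w' ws ws' hw h IH] t g /=; first exact: xreds_refl.
apply: xreds_trans (xreds_push _ g _) _ => //.
inversion g; subst; apply: xreds_trans (IH _ _) => //.
exact/xreds_appr/xreds_appr.
Qed.

Lemma lcv_App t u : ~~ isM t -> lcv t -> lcv u -> lcv (XApp t u).
Proof.
move=> tM [ct ot] [cu ou]; split.
  move: ct cu; rewrite /clean /= !negb_or => -> ->; case: t tM {ot} => //=;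
    by case: (u).
move=> k v kC o; inversion o; subst => //.
- by case/negP: tM; apply: isC_isM.
- exact: ot.
- exact: ou.
Qed.

Lemma lcv_apps t ws : ~~ isM t -> lcv t -> List.Forall lcv ws -> lcv (apps t ws).
Proof.
move=> tM lt h; elim: h t tM lt => //= {}w {}ws lw _ IH t tM lt.
by apply: IH => //; apply: lcv_App.
Qed.

Lemma lcv_apps_inv t ws : lcv (apps t ws) -> lcv t /\ List.Forall lcv ws.
Proof.
elim: ws t => [|w ws IH] t /=; first by split.
by move=> /IH [/lcv_app [lt lw] lws]; split=> //; constructor.
Qed.

Lemma lcv_lam w r : lcv (lsub w r) -> lcv (XLam r).
Proof.
case=> c o; split; first by apply: contra c => /= d; apply: dlam_subst d.
move=> k u kC o'; inversion o' as [|? ? o''| | |]; subst.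
by apply: o => //; have := occ_subst (scons w XL) XM o''; rewrite -/(lsub _ _) lsub_lshift.
Qed.

Lemma lcv_mu k u : isC k -> lcv (msub k u) -> lcv (XMu u).
Proof.
move=> kC [c o]; split; first by apply: contra c => /= d; apply: dlam_subst d => -[].
move=> k' v kC' o'; inversion o' as [| |? ? o''| |]; subst.
by apply: o => //; have := occ_subst XL (scons k XM) o''; rewrite -/(msub _ _) msub_mshift.
Qed.

Lemma good_args ws ws' k : good (pushes ws k) ->
  List.Forall2 (xreds true) ws ws' -> List.Forall okv ws'.
Proof.
move=> g h; elim: h g => {ws ws'} [|w w' ws ws' hw _ IH] g; constructor.
  by inversion g; subst; apply: okv_reds hw.
by inversion g; subst; apply: IH.
Qed.

Lemma head_exp_good k t : head_exp k t -> good k.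
Proof. by elim=> {k t} // [k _ ws _ /good_pushes|k r w ws _ _ IH] //; apply: IH (xreds_refl _ w). Qed.

Lemma head_exp_lcv k t : head_exp k t -> lcv t.
Proof.
elim=> {k t}.
- by move=> k t _ /ok_lcv/lcv_app [].
- move=> k u ws ws' g h o; apply: lcv_apps => //.
    exact: lcv_mu (good_isC g) (ok_lcv o).
  by apply: List.Forall_impl (good_args g h) => v /okv_lcv.
- move=> k r w ws ow _ IH; have /lcv_apps_inv [lr lws] := IH _ (xreds_refl _ w).
  apply: lcv_apps => //; apply: lcv_App (lcv_lam lr) (okv_lcv ow) => //.
- by move=> v k r _ _ IH; apply: lcv_lam (IH _ (xreds_refl _ v)).
Qed.

Definition cmu (v u : xterm) : xterm :=
  xsubst XL (scons (cmu_arg (XM 0) (xmshift v)) (fun a => XM a.+1)) u.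

Lemma msub_cmu k v u : isC k -> msub k (cmu v u) = msub (cmu_arg k v) u.
Proof.
move=> kC; rewrite /msub /cmu xsubst_xsubst; apply: xsubst_ext => [x|[|a]] //=.
rewrite /cmu_arg /= closed_ren; last exact: isC_closed.
by do 3 f_equal; rewrite !xsubst_xren [RHS]xren_subst; apply: xsubst_ext => -[].
Qed.

Lemma cmu_arg_reds b k w w' : isC k -> closed w -> b || isBot k ->
  xreds b w w' -> xreds b (Push w k) (cmu_arg k w').
Proof.
move=> kC cw hb h.
apply: xreds_trans (xreds_contract (X_push cw kC hb)) _.
apply/xreds_lam/xreds_appr/xreds_appr.
by rewrite -{1}(closed_ren succn id cw); apply: xreds_ren.
Qed.

Lemma msub_cmu_reds k w w' u : good (Push w k) -> xreds true w w' ->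
  xreds true (msub (Push w k) u) (msub k (cmu w' u)).
Proof.
move=> g h; inversion g; subst; rewrite msub_cmu; last exact: good_isC.
by apply/msub_reds/cmu_arg_reds => //; apply: good_isC.
Qed.

Definition etamu (u : xterm) : xterm :=
  xsubst (fun x => XL x.+1)
    (scons (XLam (XApp (XM 0) (XApp (XL 0) (XL 1)))) (fun a => XM a.+1)) u.

Lemma lsub_etamu v u : lsub v (XMu (etamu u)) = XMu (cmu v u).
Proof.
rewrite /lsub /etamu /cmu /= xsubst_xsubst; f_equal.
by apply: xsubst_ext => [x|[|a]].
Qed.

Lemma dlam_split P Q u : dlam P Q u -> dlam P xpred0 u || dlam xpred0 Q u.
Proof.
elim: u P => //= [u IH|u IHu v IHv] P.
  move/IH; case/orP => [->//|h]; apply/orP; right.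
  by have -> : scons false xpred0 = xpred0 by apply: scons_ext.
case/or3P => [|/IHu/orP [->|->]|/IHv/orP [->|->]]; rewrite ?orbT //.
case: v {IHv} => // v; case: u {IHu} => //= [a ->|o ->|w k ->] //=; by rewrite ?orbT.
Qed.

Lemma dlam_mono (P P' : nat -> bool) Q u :
  (forall a, P a -> P' a) -> dlam P Q u -> dlam P' Q u.
Proof.
by move=> h d; rewrite -(xsubst_id u); apply: dlam_subst d => a /h.
Qed.

Lemma dlam_monoQ P Q u : dlam P xpred0 u -> dlam P Q u.
Proof.
elim: u P => //= [u IH|u IHu v IHv] P; first exact: IH.
case/or3P => [|/IHu->|/IHv->]; rewrite ?orbT //.
by case: v {IHv} => // v; case: u {IHu} => //= a ->.
Qed.

Lemma dlam0 u : dlam xpred0 xpred0 u = false.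
Proof.
apply/negP; elim: u => //= [u IH|u IHu v IHv].
  by have -> : scons false xpred0 = xpred0 by apply: scons_ext.
by case/or3P => //; case: v {IHv} => //; case: u {IHu}.
Qed.

Lemma xnum_ren r q n : xren r q (xnum n) = xnum n.
Proof. by elim: n => //= n ->. Qed.

Lemma xnum_msub k u n : isM k -> msub k u = xnum n -> u = xnum n.
Proof.
rewrite /msub => kM; elim: n u => [|n IH] u.
  by case: u => //= -[|a] //= e; rewrite e in kM.
case: u => //= [[|a] //= e|u v [e /IH ->]]; first by rewrite e in kM.
by case: u e => //= -[|a] //= e; rewrite e in kM.
Qed.

Lemma mu_progress k u : isC k -> answers (msub k u) -> progress k (XMu u).
Proof.
move=> kC [r h a].
have kM := isC_isM kC.
have mM b : isM (scons k XM b) by case: b.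
have [kR|kN] := boolP (isR k); last first.
  left; case: k kN kC {kM h a mM} => //= _ k.
  by rewrite negbK => ? _; left.
have mR b : isR (scons k XM b) by case: b.
have [u' hu e] : exists2 u', xreds false u u' & r = msub k u'.
  exact: (xreds_subst_inv (s := XL) (m := scons k XM)).
apply: progress_exp (xreds_mu hu) _; subst => {u h hu}.
case: a => [d|n o|k' kN o].
- pose P' a := (a == 0) && isPushN k.
  have {d} : dlam P' isPushN u'.
    by apply: (dlam_subst_inv _ mM _ d) => // -[] //=; rewrite /P' /=; case: (k).
  case/dlam_split/orP => d.
    have kN : isPushN k.
      apply: contraT => /negbTE kN; move: d; have -> : P' = xpred0.
        by apply: functional_extensionality => b; rewrite /P' kN andbF.
      by rewrite dlam0.
    have {}d : dlam (pred1 0) xpred0 u' by apply: dlam_mono d => a /andP [].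
    left; case: k kN {kC kM mM kR mR P'} => // v k kN.
    by right; left; eexists; apply/xreds_contract/X_5.
  right; exists (XMu u') => //; apply: answer_lam => /=.
  by apply: dlam_mono d.
- have [c [v [o' e1 e2]]] := occ_subst_inv (s := XL) (m := scons k XM) (fun=> isT) mM o.
  have ev := xnum_msub kM (esym e2); subst v => {e2 o}.
  case: c o' e1 => //= [[|a]//|o0] o1 e1.
    move: e1 => /= <-; left; apply/xreds_contract/X_6.
    by rewrite xnum_ren.
  case: e1 o1 => <- o1; right; exists (XMu u') => //.
  by apply: (@answer_num _ n); apply: occ_mu; rewrite /= xnum_ren.
- have [c [v [o' e1 e2]]] := occ_subst_inv (s := XL) (m := scons k XM) (fun=> isT) mM o.
  have ev : v = Next by case: v e2 {o'} => //= -[|a] //= e2; rewrite -e2 in kM.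
  subst v => {e2 o}.
  case: k' kN e1 => // v0 k0 kN; case: c o' => //= [[|a]|v1 k1] o1 // e1.
    by move: e1 => /= <-; left; right; right; apply/xreds_contract/X_6.
  case: e1 o1 => <- <- o1; right; exists (XMu u') => //.
  by apply: (@answer_next _ (Push v0 k0)) => //; apply: occ_mu.
Qed.

Lemma apps_mu_reds ws ws' k u : good (pushes ws k) ->
  List.Forall2 (xreds true) ws ws' -> ok (msub (pushes ws k) u) ->
  exists2 u', xreds false (apps (XMu u) ws') (XMu u') & ok (msub k u').
Proof.
move=> g h; elim: h u g => {ws ws'} [|w w' ws ws' hw h IH] u g o /=.
  by exists u.
have g' : good (pushes ws k) by inversion g.
case: (IH (cmu w' u) g' (ok_reds o (msub_cmu_reds u g hw))) => u' hu o'.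
exists u' => //; apply: xreds_trans hu; apply/xreds_apps/xreds_contract.
exact: X_mu.
Qed.

Lemma head_exp_progress k t : head_exp k t -> progress k t.
Proof.
elim=> {k t}.
- by move=> k t /good_isC kC /ok_local/local_progress; apply.
- move=> k u ws ws' g h o; case: (apps_mu_reds g h o) => u' hu o'.
  apply: progress_exp hu (mu_progress (good_isC (good_pushes g)) _).
  exact/local_answers/ok_local.
- move=> k r w ws _ _ IH; apply: progress_exp (IH _ (xreds_refl _ w)).
  exact/xreds_apps/xreds_contract/X_lam.
- by move=> v k r _ _ _; left; right; left; exists r.
Qed.

Lemma head_exp_red k t t' : head_exp k t -> xred true t t' -> head_exp k t'.
Proof.
move=> h; elim: h t' => {k t}.
- move=> k t g o t' r; apply: exp_ok => //; apply: (ok_lred o).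
  exact/lred_red/xred_appr.
- move=> k u ws ws' g h o t' r; have kC := good_isC g.
  case: (spine_red _ _ r) => [//|? ? ? //|[z hz ->]|[ws2 hw ->]|[w [ws2 [z [e c ->]]]]].
  + inversion hz as [? ? c| |? u' hu| |]; subst; last first.
      by apply: exp_mu g h _; apply: (ok_reds o); apply/xreds_step/msub_red => //; apply: isC_isM.
    inversion c as [| | |u' e| | |? d|? ? oc| |? ? kM|]; subst => //.
    * apply: exp_mu g h _.
      have := ok_lred o (lred_mu _); move/ok_reds; apply.
      rewrite [X in xreds _ _ X]msub_subst.
      apply: msub_reds; apply: xreds_trans (xreds_contract (X_eta _ _)) _ => //.
      exact/xreds_lam/xreds_contract/X_bot.
    * inversion h as [|w w' ws1 ws1' hw h']; subst => /=.
        case: k g kC o => [||||||| b|v k] //= g kC o.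
          case/negP: (local_clean (ok_local o)).
          apply: (dlam_subst (P' := pred1 0)); last exact: dlam_monoQ d.
          by move=> a /eqP->.
        apply: exp_push => // v' hv; rewrite -/(etamu u) lsub_etamu.
        apply: (@exp_mu k _ [::] [::]) => //=; first by inversion g.
        by apply: (ok_reds o); apply: msub_cmu_reds.
      have g' : good (pushes ws1 k) by inversion g.
      apply: exp_lam => [|w2 hw2].
        by inversion g; subst; apply: okv_reds hw.
      rewrite -/(etamu u) lsub_etamu; apply: exp_mu g' h' _.
      apply: (ok_reds o); apply: msub_cmu_reds => //.
      exact: xreds_trans hw hw2.
    * apply: exp_ok (good_pushes g) _; apply: ok_reds (pushes_reds _ g h).
      apply: (ok_lred o); apply: lred_occ => //.
      have := occ_subst XL (scons (pushes ws k) XM) oc.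
      by rewrite /= -/(msub _ _) msub_mshift.
  + exact: exp_mu g (Forall2_xred1 h hw) o.
  + inversion c as [|? ? e1|? ? ? hM| | | | | | | |]; subst => //.
    inversion h as [|w0 ? ws1 ? hw h']; subst.
    have g' : good (pushes ws1 k) by inversion g.
    apply: exp_mu g' h' _.
    exact: (ok_reds o (msub_cmu_reds u g hw)).
- move=> k r w ws ow hw IH t' h.
  case: (spine_red _ _ h) => [//|? ? hM [e _]|[z hz ->]|[ws2 hws ->]|[w' [ws2 [z [e c ->]]]]].
  + by rewrite -e in hM.
  + inversion hz as [? ? c| | |? z' ? hl|? ? w' hw']; subst.
    * inversion c; subst => //; exact: hw.
    * inversion hl as [? ? c|? r' hr| | |]; subst; first by inversion c.
      by apply: exp_lam => // w' hw'; apply: IH hw' _ _; apply/xred_apps/lsub_red.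
    * apply: exp_lam => [|w2 hw2]; first exact: okv_reds ow (xreds_step hw').
      by apply: hw; apply: xreds_trans (xreds_step hw') hw2.
  + by apply: exp_lam => // w' hw'; apply: IH hw' _ _; apply: xred_args.
  + by inversion c as [| |? ? ? hM| | | | | | | |].
- move=> v k r g hv IH t' h.
  inversion h as [? ? c|? r' hr| | |]; subst; first by inversion c.
  by apply: exp_push => // v' hv'; apply: IH hv' _ _; apply: lsub_red.
Qed.

Lemma head_exp_push v k v' t : xreds true v v' -> head_exp (Push v k) t ->
  head_exp k (XApp t v').
Proof.
move=> hv; move e : (Push v k) => k0 h; elim: h v k hv e => {k0 t}.
- move=> ? t g o v k hv e; subst; apply: exp_ok; first by inversion g.
  apply: ok_reds o _; apply: xreds_trans (xreds_push _ g _) _ => //.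
  exact/xreds_appr/xreds_appr.
- move=> ? u ws ws' g h o v k hv e; subst; rewrite -apps_rcons.
  apply: (@exp_mu k u (rcons ws v)).
  + by rewrite foldr_rcons.
  + by rewrite -!cats1; apply: List.Forall2_app h _; constructor.
  + by rewrite foldr_rcons.
- move=> ? r w ws ow _ IH v k hv e; subst; rewrite -apps_rcons.
  by apply: exp_lam => // w' hw'; rewrite apps_rcons; apply: (IH w' hw' v).
- move=> v0 k0 r g hr _ v k hv [? ?]; subst; apply: (@exp_lam _ r v' [::]) => /=.
    by inversion g; subst; apply: okv_reds hv.
  by move=> w' hw'; apply: hr; apply: xreds_trans hv hw'.
Qed.

Lemma head_exp_ok k t : head_exp k t -> ok (XApp k t).
Proof.
apply: coind_ok => {}k {}t h; split; first exact: head_exp_good h.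
case: (h) => {k t h} [k t g o|k u ws ws' g hws o|k r w ws ow hw|v k r g hr].
- by left.
- have h := exp_mu g hws o; right; split.
  + by move=> t' /(head_exp_red h).
  + by move=> v k' v' e hv; subst; apply: head_exp_push h.
  + exact: head_exp_lcv h.
  + exact: head_exp_progress h.
  + by move=> _; apply: isLam_apps.
  + move=> u'; inversion hws as [|w w' ws1 ws1' hw hws' e1 e2]; subst; first by case=> <-.
    by have [//|x [y ->]] := @apps_app (XMu u) (w' :: ws1').
  + move=> h' u' hM; case/lastP: ws' {hws h} => // ws' w'.
    rewrite apps_rcons => -[e _]; move: hM.
    by rewrite -e (negbTE (isM_apps _ _)).
- have h := exp_lam ow hw; right; split.
  + by move=> t' /(head_exp_red h).
  + by move=> v k' v' e hv; subst; apply: head_exp_push h.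
  + exact: head_exp_lcv h.
  + exact: head_exp_progress h.
  + by move=> _; apply: isLam_apps.
  + by move=> u'; case/lastP: ws {hw h} => // ws' w'; rewrite apps_rcons.
  + move=> h' u' hM; case/lastP: ws {hw h} => [[e _]|ws' w'].
      by rewrite -e in hM.
    rewrite apps_rcons => -[e _]; move: hM.
    by rewrite -e (negbTE (isM_apps _ _)).
- have h := exp_push g hr; right; split=> //.
  + by move=> t' /(head_exp_red h).
  + by move=> v0 k' v' e hv; rewrite e in h; apply: head_exp_push h.
  + exact: head_exp_lcv h.
  + exact: head_exp_progress h.
Qed.

Lemma ok_mu k u : good k -> ok (msub k u) -> ok (XApp k (XMu u)).
Proof. by move=> g o; apply/head_exp_ok/(@exp_mu k u [::] [::]). Qed.

Lemma ok_lam v k r : good (Push v k) -> ok (XApp k (lsub v r)) ->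
  ok (XApp (Push v k) (XLam r)).
Proof.
move=> g o; apply/head_exp_ok/exp_push => // v' hv; apply: exp_ok; first by inversion g.
exact/(ok_reds o)/xreds_appr/lsub_reds.
Qed.

(** * Embedding of the terms *)

Fixpoint emb (t : term) : xterm :=
  match t with
  | Lvar x => XL x
  | Mvar a => XM a
  | Lam u => XLam (emb u)
  | Mu u => XMu (emb u)
  | App u v => XApp (emb u) (emb v)
  end.

Lemma emb_inj : injective emb.
Proof.
elim=> [x|a|u IH|u IH|u IHu v IHv] [y|b|u'|u'|u' v'] //=.
- by case=> ->.
- by case=> ->.
- by case=> /IH->.
- by case=> /IH->.
- by case=> /IHu-> /IHv->.
Qed.

Lemma emb_ren r q t : emb (ren r q t) = xren r q (emb t).
Proof. by elim: t r q => //= [u IH|u IH|u IHu v IHv] r q; rewrite ?IH ?IHu ?IHv. Qed.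

Lemma emb_subst s m t : emb (subst s m t) = xsubst (emb \o s) (emb \o m) (emb t).
Proof.
elim: t s m => //= [u IH|u IH|u IHu v IHv] s m; last by rewrite IHu IHv.
- rewrite IH; do 2 f_equal; last first.
    by apply: functional_extensionality => a /=; apply: emb_ren.
  by symmetry; apply: scons_ext => //= n; apply: emb_ren.
- rewrite IH; do 2 f_equal.
    by apply: functional_extensionality => a /=; apply: emb_ren.
  by symmetry; apply: scons_ext => //= n; apply: emb_ren.
Qed.

Lemma emb_lsub u v : emb (subst (scons v Lvar) Mvar u) = lsub (emb v) (emb u).
Proof. by rewrite emb_subst; apply: xsubst_ext => [[]|]. Qed.

Lemma emb_msub u v : emb (subst Lvar (scons v Mvar) u) = msub (emb v) (emb u).
Proof. by rewrite emb_subst; apply: xsubst_ext => [|[]]. Qed.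

Lemma emb_cmu u v :
  emb (subst Lvar (scons (Lam (App (Mvar 0) (App (Lvar 0) (lshift (mshift v)))))
    (fun a => Mvar a.+1)) u) = cmu (emb v) (emb u).
Proof.
rewrite emb_subst; apply: xsubst_ext => [|[]] //=.
by rewrite /cmu_arg !emb_ren.
Qed.

Lemma emb_etamu u :
  emb (subst (fun x => Lvar x.+1)
    (scons (Lam (App (Mvar 0) (App (Lvar 0) (Lvar 1)))) (fun a => Mvar a.+1)) u) =
  etamu (emb u).
Proof. by rewrite emb_subst; apply: xsubst_ext => [|[]]. Qed.

Lemma emb_applied a u : applied_to_lam a u = dlam (pred1 a) xpred0 (emb u).
Proof.
elim: u a => //= [u IH|u IHu v IHv] a.
  by rewrite IH; f_equal; symmetry; apply: scons_ext.
rewrite IHu IHv; f_equal.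
by case: v {IHv} => //; case: u {IHu}.
Qed.

Lemma occ_lfree x s m u : lfree x u ->
  occ (s x) (xsubst s m (emb u)).
Proof.
elim: u x s m => //= [y|u IH|u IH|u IHu v IHv] x s m.
- by move/eqP=> ->; apply: occ_refl.
- by move=> /IH h; apply: occ_lam; apply: h.
- by move=> /IH h; apply: occ_mu; apply: (h (fun x => xmshift (s x))).
- by case/orP => [/IHu h|/IHv h]; [apply: occ_appl | apply: occ_appr].
Qed.

Lemma lfree_ren r q u x y : lfree x u -> r x = y -> lfree y (ren r q u).
Proof.
elim: u r q x y => //= [z|u IH|u IH|u IHu v IHv] r q x y.
- by move=> /eqP-> ->.
- by move=> /IH h e; apply: h => /=; rewrite e.
- by move=> /IH h e; apply: h.
- by case/orP => [/IHu h|/IHv h] /h->; rewrite ?orbT.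
Qed.

Lemma emb_lshift_inv t t' : xlshift t = emb t' ->
  exists2 u, t = emb u & t' = lshift u.
Proof.
move=> e; have et : t = emb (ren predn id t').
  by rewrite emb_ren -e xren_xren -[LHS]xren_id.
by exists (ren predn id t') => //; apply: emb_inj; rewrite emb_ren -et.
Qed.

Lemma emb_mshift_inv t t' : xmshift t = emb t' ->
  exists2 u, t = emb u & t' = mshift u.
Proof.
move=> e; have et : t = emb (ren id predn t').
  by rewrite emb_ren -e xren_xren -[LHS]xren_id.
by exists (ren id predn t') => //; apply: emb_inj; rewrite emb_ren -et.
Qed.

Lemma emb_eq_lam t u : emb t = XLam u -> exists2 t', t = Lam t' & u = emb t'.
Proof. by case: t => //= t [<-]; exists t. Qed.
Lemma emb_eq_mu t u : emb t = XMu u -> exists2 t', t = Mu t' & u = emb t'.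
Proof. by case: t => //= t [<-]; exists t. Qed.
Lemma emb_eq_app t u v : emb t = XApp u v ->
  exists t1 t2, [/\ t = App t1 t2, u = emb t1 & v = emb t2].
Proof. by case: t => //= t1 t2 [<- <-]; exists t1, t2. Qed.
Lemma emb_isM t : isM (emb t) -> exists a, t = Mvar a.
Proof. by case: t => //= a _; exists a. Qed.

Definition swap (n : nat) : nat := match n with 0 => 1 | 1 => 0 | m => m end.

Lemma occ_emb t u : occ t (emb u) ->
  exists t' u', [/\ t = emb t', lfree 0 u' &
                    u = subst (scons t' Lvar) Mvar u'].
Proof.
elim: u t => [x|a|u IH|u IH|u IHu v IHv] t o.
- by inversion o; subst; exists (Lvar x), (Lvar 0).
- by inversion o; subst; exists (Mvar a), (Lvar 0).
- inversion o as [|? ? o'| | |]; subst; first by exists (Lam u), (Lvar 0).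
  case: (IH _ o') => t1 [u1 [/emb_lshift_inv [t2 -> ->] f ->]].
  exists t2, (Lam (ren swap id u1)); split=> //=; first exact: lfree_ren f _.
  congr Lam; apply: emb_inj; rewrite !emb_subst emb_ren xsubst_xren.
  by apply: xsubst_ext => [[|[|x]]|a].
- inversion o as [| |? ? o'| |]; subst; first by exists (Mu u), (Lvar 0).
  case: (IH _ o') => t1 [u1 [/emb_mshift_inv [t2 -> ->] f ->]].
  exists t2, (Mu u1); split=> //=.
  by congr Mu; apply: emb_inj; rewrite !emb_subst; apply: xsubst_ext => [[|x]|[|a]].
- inversion o as [| | |? ? ? o'|? ? ? o']; subst; first by exists (App u v), (Lvar 0).
  + case: (IHu _ o') => t1 [u1 [-> f e]].
    exists t1, (App u1 (lshift v)); split=> //=; first by rewrite f.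
    rewrite -e; congr App; apply: emb_inj; rewrite emb_lsub emb_ren.
    by rewrite lsub_lshift.
  + case: (IHv _ o') => t1 [v1 [-> f e]].
    exists t1, (App (lshift u) v1); split=> //=; first by rewrite f orbT.
    rewrite -e; congr App; apply: emb_inj; rewrite emb_lsub emb_ren.
    by rewrite lsub_lshift.
Qed.

Lemma contract_emb b t t' : contract t t' -> xcontract b (emb t) (emb t').
Proof.
case=> {t t'} /=.
- by move=> u v; rewrite emb_lsub; apply: X_lam.
- by move=> u v; rewrite emb_cmu; apply: X_mu.
- by move=> a u v; apply: X_1.
- by move=> u; rewrite emb_msub; apply: X_2.
- by move=> a c u; apply: X_3.
- by move=> c u; rewrite emb_msub; apply: X_4.
- by move=> u; rewrite emb_applied emb_etamu; apply: X_5.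
- move=> u v f; apply: X_6; rewrite emb_subst.
  have := occ_lfree (emb \o scons (App (Mvar 0) (mshift v)) Lvar) (emb \o Mvar) f.
  by rewrite /= emb_ren.
Qed.

Lemma red_emb b t t' : red t t' -> xred b (emb t) (emb t').
Proof.
elim=> {t t'} /= *; try by constructor.
exact/xred_contract/contract_emb.
Qed.

Lemma reds_emb b t t' : reds t t' -> xreds b (emb t) (emb t').
Proof.
elim=> {t t'} [t t' h|t|t u v _ h1 _ h2].
- exact/xreds_step/red_emb.
- exact: xreds_refl.
- exact: xreds_trans h1 h2.
Qed.

Lemma contract_emb_inv t z : xcontract false (emb t) z ->
  exists2 t', contract t t' & z = emb t'.
Proof.
move=> c; inversion c as [u v e|u v e|h u v hM e|u e|h h' u hM hM' e|h u hM e|u hu e|u v o e|v k cv kC kb e|k fb|u fb e] => //; subst.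
- case: (emb_eq_app (esym e)) => t1 [t2 [-> e1 ->]].
  case: (emb_eq_lam (esym e1)) => u' -> ->.
  by rewrite -emb_lsub; eexists; first exact: C_lambda.
- case: (emb_eq_app (esym e)) => t1 [t2 [-> e1 ->]].
  case: (emb_eq_mu (esym e1)) => u' -> ->.
  eexists; first exact: C_mu.
  by rewrite /= emb_cmu.
- case: (emb_eq_app (esym e)) => t1 [t2 [-> e1 e2]].
  case: (emb_eq_app (esym e1)) => t3 [t4 [-> e3 e4]]; subst.
  case: (emb_isM hM) => a ->.
  by eexists; first exact: S1.
- case: (emb_eq_mu (esym e)) => u1 -> e1.
  case: (emb_eq_mu (esym e1)) => u2 -> ->.
  by eexists; first exact: S2; rewrite /= emb_msub.
- case: (emb_eq_app (esym e)) => t1 [t2 [-> e1 e2]].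
  case: (emb_eq_app (esym e2)) => t3 [t4 [-> e3 e4]]; subst.
  case: (emb_isM hM) => a ->; case: (emb_isM hM') => a' ->.
  by eexists; first exact: S3.
- case: (emb_eq_app (esym e)) => t1 [t2 [-> e1 e2]].
  case: (emb_eq_mu (esym e2)) => t3 -> e3; subst.
  case: (emb_isM hM) => a ->.
  by eexists; first exact: S4; rewrite emb_msub.
- case: (emb_eq_mu (esym e)) => u1 -> e1; subst.
  eexists; first by apply: S5; rewrite emb_applied.
  by rewrite /= emb_etamu.
- case: (emb_eq_mu (esym e)) => u1 -> e1; subst.
  case: (occ_emb o) => t1 [u2 [/esym/emb_eq_app [t2 [t3 [-> e1 e2]]] f ->]].
  case: (emb_mshift_inv e2) => t4 -> e4; subst.
  case: t2 e1 f {o c e} => //= a [<-] f.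
  by exists t4 => //; apply: S6.
- by case: t c e.
Qed.

Lemma red_emb_inv t z : xred false (emb t) z ->
  exists2 t', red t t' & z = emb t'.
Proof.
elim: t z => [x|a|t IH|t IH|t1 IH1 t2 IH2] z h;
  (inversion h as [? ? c|u u' h' e|u u' h' e|u u' v' h' e|u v0 v' h' e]; subst;
  first by case: (contract_emb_inv c) => t' c' ->; exists t' => //;
    apply: red_contract).
- by case: (IH _ h') => t' r ->; exists (Lam t') => //; apply: red_lam.
- by case: (IH _ h') => t' r ->; exists (Mu t') => //; apply: red_mu.
- by case: (IH1 _ h') => t' r ->; exists (App t' t2) => //; apply: red_appl.
- by case: (IH2 _ h') => t' r ->; exists (App t1 t') => //; apply: red_appr.
Qed.

Lemma reds_emb_inv t z : xreds false (emb t) z ->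
  exists2 t', reds t t' & z = emb t'.
Proof.
move e : (emb t) => u h; elim: h t e => {u z} [u z h|u|u v z _ IH1 _ IH2] t e.
- by rewrite -e in h; case: (red_emb_inv h) => t' h' ->; exists t' => //; apply: rt_step.
- by exists t => //; apply: rt_refl.
- case: (IH1 _ e) => t1 h1 e1; case: (IH2 _ (esym e1)) => t2 h2 ->.
  by exists t2 => //; apply: rt_trans h1 h2.
Qed.

Fixpoint pure (t : xterm) : bool :=
  match t with
  | XLam u | XMu u => pure u
  | XApp u v => pure u && pure v
  | Base _ | Push _ _ => false
  | _ => true
  end.

Lemma pure_ren r q t : pure (xren r q t) = pure t.
Proof. by elim: t r q => //= [u IHu v IHv] r q; rewrite IHu IHv. Qed.

Lemma pure_occ t u : occ t u -> pure u -> pure t.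
Proof.
elim=> {t u} //= [t u _ IH /IH|t u _ IH /IH|t u v _ IH /andP [/IH]|t u v _ IH /andP [_ /IH]] //;
  by rewrite pure_ren.
Qed.

Lemma pure_dlam t Q : pure t -> dlam xpred0 Q t = false.
Proof.
elim: t => //= [u IH /IH|u IHu v IHv /andP [pu pv]].
  by have -> : scons false xpred0 = xpred0 by apply: scons_ext.
rewrite IHu // IHv // !orbF; case: v {IHv pv} => // v; by case: u pu {IHu}.
Qed.

Lemma pure_emb s t : (forall x, pure (s x)) -> pure (xsubst s XM (emb t)).
Proof.
elim: t s => //= [t IH|t IH|u IHu v IHv] s hs.
- by apply: IH => -[|x] //=; rewrite pure_ren.
- have -> : mup XM = XM by apply: scons_ext.
  by apply: IH => x /=; rewrite pure_ren.
- by rewrite IHu // IHv.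
Qed.

Lemma pure_progress s k t : (forall x, lleaf (s x)) ->
  progress k (xsubst s XM (emb t)) -> value_at k (xsubst s XM (emb t)).
Proof.
move=> sl [//|[z h a]].
have [z' hz e] := xreds_subst_inv (m := XM) sl (fun=> isT) h.
have [t' _ e'] := reds_emb_inv hz; subst.
have p : pure (xsubst s XM (emb t')).
  by apply: pure_emb => x; move: (sl x); case: (s x).
case: a => [d|n /pure_occ /(_ p) //|c cN /pure_occ /(_ p) /=].
  by rewrite pure_dlam in d.
by case: c cN.
Qed.

Lemma reds_subst_emb s t z : (forall x, lleaf (s x)) ->
  xreds false (xsubst s XM (emb t)) z ->
  exists2 t', reds t t' & z = xsubst s XM (emb t').
Proof.
move=> sl h; have [z' hz ->] := xreds_subst_inv (m := XM) sl (fun=> isT) h.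
by have [t' ht ->] := reds_emb_inv hz; exists t'.
Qed.

(** * Interpretation of the formulas *)

(* A formula is interpreted by a set of stack constants, a term belonging to
   it when it is [ok] against all of them; quantifiers are unions of stacks. *)
Definition stacks := xterm -> Prop.

Lemma stacks_ext (S S' : stacks) : (forall k, S k <-> S' k) -> S = S'.
Proof.
by move=> h; apply: functional_extensionality => k; apply: propositional_extensionality.
Qed.

Definition member (S : stacks) (t : xterm) : Prop :=
  closed t /\ forall k, S k -> ok (XApp k t).

Record candidate (S : stacks) : Prop := Candidate {
  cand_inh : exists k, S k;
  cand_good : forall k, S k -> good k }.

Definition arrow (S S' : stacks) : stacks := fun k =>
  exists v k', [/\ k = Push v k', member S v & S' k'].

Lemma member_okv S t : candidate S -> member S t -> okv t.
Proof. by case=> -[k Sk] _ [_ h]; apply: okv_appr (ok_okv (h _ Sk)). Qed.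

Lemma member_inh S : candidate S -> exists t, member S t.
Proof.
move=> cS; exists (XMu (XApp (Base (Some 0)) Zero)); split=> // k /(cand_good cS) g.
by apply: ok_mu g _; apply: ok_zero.
Qed.

Lemma candidate_arrow S S' : candidate S -> candidate S' -> candidate (arrow S S').
Proof.
move=> cS cS'; have [t mt] := member_inh cS; have [k Sk] := cand_inh cS'; split.
  by exists (Push t k), t, k.
move=> _ [v [k' [-> mv Sk']]]; apply: good_push; [by case: mv | exact: member_okv mv |].
exact: cand_good cS' _ Sk'.
Qed.

Lemma member_app S S' t v : candidate S -> candidate S' ->
  member (arrow S S') t -> member S v -> member S' (XApp t v).
Proof.
move=> cS cS' [ct ht] mv; split; first by move=> s m /=; rewrite ct; case: mv => ->.
move=> k Sk; have h : arrow S S' (Push v k) by exists v, k.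
apply: ok_reds (ht _ h) (xreds_push _ _ _) => //.
exact: (cand_good (candidate_arrow cS cS')).
Qed.

Lemma scons2_eq (T : Type) n (a : T) f : scons2 n a f n = scons a (f n).
Proof. by rewrite /scons2 eqxx. Qed.

Lemma scons2_neq (T : Type) n (a : T) f n' : n' != n -> scons2 n a f n' = f n'.
Proof. by rewrite /scons2 => /negbTE->. Qed.

Section Interp.
Variables (F : Type) (ar : F -> nat) (E : fterm ar -> fterm ar -> Prop).
Notation ft := (fterm ar).
Notation penv := (nat -> nat -> (nat -> ft) -> stacks).

Lemma ftsubst_comp (th th' : nat -> ft) a :
  ftsubst th (ftsubst th' a) = ftsubst (fun n => ftsubst th (th' n)) a.
Proof.
elim: a => //= [a -> //|f args IH]; congr FApp.
by apply: functional_extensionality => j; apply: IH.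
Qed.

Lemma eqE_subst (th : nat -> ft) a b : eqE E a b -> eqE E (ftsubst th a) (ftsubst th b).
Proof.
elim=> {a b} /=.
- by move=> a b th' h; rewrite !ftsubst_comp; apply: eqE_ax.
- by move=> a; apply: eqE_refl.
- by move=> a b _; apply: eqE_sym.
- by move=> a b c _ h _; apply: eqE_trans h.
- by move=> a b _; apply: eqE_succ.
- by move=> f a b _ h; apply: eqE_app.
Qed.

Lemma eqE_substl (th th' : nat -> ft) a : (forall n, eqE E (th n) (th' n)) ->
  eqE E (ftsubst th a) (ftsubst th' a).
Proof.
move=> h; elim: a => /= [n||a IH|||f args IH] //; try exact: eqE_refl.
  exact: eqE_succ.
exact: eqE_app.
Qed.

(* A predicate of arity [k] is a function of a sequence of individuals that
   only depends on its first [k] values (see [valid]); [fargs] pads the list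
   of arguments with [FZero]. *)
Definition fargs k (args : 'I_k -> ft) (th : nat -> ft) (n : nat) : ft :=
  if insub n is Some j then ftsubst th (args j) else FZero.

Definition with_params k (l th : nat -> ft) (n : nat) : ft :=
  if n < k then l n else th (n - k).

Fixpoint interp (A : form ar) (th : nat -> ft) (rho : penv) : stacks :=
  match A with
  | Bot => fun k => k = Base None
  | PVar k i args => rho k i (fargs args th)
  | Imp B C => arrow (interp B th rho) (interp C th rho)
  | All1 B => fun k => exists d, interp B (scons d th) rho k
  | All2 n B => fun k => exists P : (nat -> ft) -> stacks,
     [/\ forall l, candidate (P l),
         forall l l', (forall j, j < n -> eqE E (l j) (l' j)) -> P l = P l' &
         interp B th (scons2 n P rho) k]
  end.

Record valid (rho : penv) : Prop := Valid {
  valid_cand : forall n i l, candidate (rho n i l);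
  valid_inv : forall n i l l',
    (forall j, j < n -> eqE E (l j) (l' j)) -> rho n i l = rho n i l' }.

Definition bot_pred (l : nat -> ft) : stacks := fun k => k = Base None.

Lemma candidate_bot : candidate (fun k => k = Base None).
Proof. by split; [exists (Base None) | move=> k ->; apply: good_base]. Qed.

Lemma valid_scons2 n P rho : valid rho -> (forall l, candidate (P l)) ->
  (forall l l', (forall j, j < n -> eqE E (l j) (l' j)) -> P l = P l') ->
  valid (scons2 n P rho).
Proof.
move=> [v1 v2] h1 h2; split=> n' i.
  by move=> l; rewrite /scons2; case: eqP => [->|_] //; case: i => [|i] /=.
rewrite /scons2; case: eqP => [->|_] l l' h; last exact: v2.
by case: i => [|i] /=; [apply: h2 | apply: v2].
Qed.

Lemma interp_cand A th rho : valid rho -> candidate (interp A th rho).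
Proof.
elim: A th rho => [|n i args|B IHB C IHC|B IH|n B IH] th rho v /=.
- exact: candidate_bot.
- exact: valid_cand.
- exact: candidate_arrow (IHB _ _ v) (IHC _ _ v).
- split=> [|k [d]]; last exact: cand_good (IH _ _ v) k.
  by have [k h] := cand_inh (IH (scons FZero th) _ v); exists k, FZero.
- split=> [|k [P [h1 h2]]]; last by apply: cand_good; apply/IH/valid_scons2.
  have v' : valid (scons2 n bot_pred rho) by apply: valid_scons2 => // l; apply: candidate_bot.
  have [k h] := cand_inh (IH th _ v'); exists k, bot_pred; split=> // l.
  exact: candidate_bot.
Qed.

Lemma interp_ext A th th' rho : valid rho -> (forall n, eqE E (th n) (th' n)) ->
  interp A th rho = interp A th' rho.
Proof.
elim: A th th' rho => [|n i args|B IHB C IHC|B IH|n B IH] th th' rho v h //=.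
- apply: valid_inv => // j jn; rewrite /fargs insubT /=; exact: eqE_substl.
- by rewrite (IHB _ _ _ v h) (IHC _ _ _ v h).
- apply: stacks_ext => k; split=> -[d hd]; exists d.
    rewrite -(IH (scons d th)) // => -[|j] //=; exact: eqE_refl.
  rewrite (IH _ (scons d th')) // => -[|j] //=; exact: eqE_refl.
- apply: stacks_ext => k; split=> -[P [h1 h2 h3]]; exists P; split=> //.
    by rewrite -(IH th) //; apply: valid_scons2.
  by rewrite (IH _ th') //; apply: valid_scons2.
Qed.

Lemma interp_subst1 A th0 th rho :
  interp (subst1 th0 A) th rho = interp A (fun n => ftsubst th (th0 n)) rho.
Proof.
elim: A th0 th rho => [|n i args|B IHB C IHC|B IH|n B IH] th0 th rho //=.
- congr rho; apply: functional_extensionality => j; rewrite /fargs.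
  by case: insub => //= j'; rewrite ftsubst_comp.
- by rewrite IHB IHC.
- apply: stacks_ext => k.
  have e d : (fun n => ftsubst (scons d th) (up1 th0 n)) =
             scons d (fun n => ftsubst th (th0 n)).
    by symmetry; apply: scons_ext => // j; rewrite /= ftsubst_comp.
  by split=> -[d hd]; exists d; move: hd; rewrite IH e.
- by apply: stacks_ext => k; split=> -[P [h1 h2 h3]]; exists P; split=> //;
  move: h3; rewrite IH.
Qed.

Lemma interp_shift1 A d th rho : interp (shift1 A) (scons d th) rho = interp A th rho.
Proof. by rewrite interp_subst1. Qed.

Lemma interp_inst1 A a th rho :
  interp (inst1 a A) th rho = interp A (scons (ftsubst th a) th) rho.
Proof.
by rewrite interp_subst1; congr interp; symmetry; apply: scons_ext.
Qed.

Lemma interp_ren2 A r th rho :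
  interp (ren2 r A) th rho = interp A th (fun n i => rho n (r n i)).
Proof.
elim: A r th rho => [|n i args|B IHB C IHC|B IH|n B IH] r th rho //=.
- by rewrite IHB IHC.
- by apply: stacks_ext => k; split=> -[d hd]; exists d; move: hd; rewrite IH.
- have e P : (fun n' i => scons2 n P rho n'
      ((if n' == n then upren (r n') else r n') i)) =
      scons2 n P (fun n' i => rho n' (r n' i)).
    apply: functional_extensionality => n'; rewrite /scons2; case: eqP => // _.
    by symmetry; apply: scons_ext.
  by apply: stacks_ext => k; split=> -[P [h1 h2 h3]]; exists P; split=> //;
  move: h3; rewrite IH e.
Qed.

Lemma interp_shift2 A n P th rho :
  interp (shift2 n A) th (scons2 n P rho) = interp A th rho.
Proof.
rewrite interp_ren2; congr interp; apply: functional_extensionality => n'.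
by apply: functional_extensionality => i; rewrite /scons2; case: eqP.
Qed.

Lemma interp_subst2 A s th rho : valid rho ->
  interp (subst2 s A) th rho =
  interp A th (fun n i l => interp (s n i) (with_params n l th) rho).
Proof.
elim: A s th rho => [|n i args|B IHB C IHC|B IH|n B IH] s th rho v //=.
- rewrite interp_subst1; congr interp; apply: functional_extensionality => j.
  rewrite /with_params /fargs; case: insubP => [j' -> //|/negbTE->] //=.
- by rewrite IHB // IHC.
- have e d : (fun n i l => interp (shift1_params n (s n i)) (with_params n l (scons d th)) rho)
    = (fun n i l => interp (s n i) (with_params n l th) rho).
    apply: functional_extensionality => n; apply: functional_extensionality => i.
    apply: functional_extensionality => l; rewrite interp_subst1.
    congr interp; apply: functional_extensionality => j /=.
    rewrite /with_params; case: (ltnP j n) => [jn|h]; first by rewrite jn.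
    by rewrite ltnNge (leqW h) /= subSn.
  by apply: stacks_ext => k; split=> -[d hd]; exists d; move: hd; rewrite IH // e.
- have e P : (forall l l', (forall j, j < n -> eqE E (l j) (l' j)) -> P l = P l') ->
    (fun n' i l => interp (scons2 n (PVar 0 (fun j : 'I_n => FVar j))
        (fun k' i => shift2 n (s k' i)) n' i) (with_params n' l th) (scons2 n P rho)) =
    scons2 n P (fun n' i l => interp (s n' i) (with_params n' l th) rho).
    move=> hP; apply: functional_extensionality => n'.
    apply: functional_extensionality => i; apply: functional_extensionality => l.
    have [->|ne] := eqVneq n' n; last by rewrite !(scons2_neq _ _ ne) interp_shift2.
    rewrite !scons2_eq; case: i => [|i] /=; last exact: interp_shift2.
    rewrite scons2_eq /=; apply: hP => j jn; rewrite /fargs insubT /=.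
    rewrite /with_params jn; exact: eqE_refl.
  apply: stacks_ext => k; split=> -[P [h1 h2 h3]]; exists P; split=> //; move: h3;
    by rewrite IH ?e //; apply: valid_scons2.
Qed.

Lemma interp_inst2 A n H th rho : valid rho ->
  interp (inst2 n H A) th rho =
  interp A th (scons2 n (fun l => interp H (with_params n l th) rho) rho).
Proof.
move=> v; rewrite interp_subst2 //; congr interp.
have e n' i l : interp (PVar i (fun j : 'I_n' => FVar j)) (with_params n' l th) rho
    = rho n' i l.
  apply: (valid_inv v) => j jn; rewrite /fargs insubT /= /with_params jn.
  exact: eqE_refl.
apply: functional_extensionality => n'; apply: functional_extensionality => i.
apply: functional_extensionality => l.
have [->|ne] := eqVneq n' n; last by rewrite !(scons2_neq _ _ ne); apply: e.
by rewrite !scons2_eq; case: i => [|i] //=; apply: e.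
Qed.

Lemma adequacy G D t A : typed E G D t A -> forall th rho s m, valid rho ->
  (forall x, closed (s x)) -> (forall a, isC (m a)) ->
  (forall x B, G x = Some B -> member (interp B th rho) (s x)) ->
  (forall a B, D a = Some B -> interp B th rho (m a)) ->
  member (interp A th rho) (xsubst s m (emb t)).
Proof.
elim=> {G D t A}.
- by move=> G D x A e th rho s m v cs cm hG hD; apply: hG.
- move=> G D a B e th rho s m v cs cm hG hD; split; first exact/isC_closed/cm.
  move=> _ [w [_ [-> mw ->]]] /=; have Sk := hD _ _ e.
  have cB := interp_cand B th v.
  apply: ok_const (cand_good cB Sk) _ (member_okv cB mw) _; first by case: mw.
  by case: mw => _; apply.
- move=> G D u A B _ IH th rho s m v cs cm hG hD.
  have cA := interp_cand A th v; have cB := interp_cand B th v.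
  split; first by apply: closed_subst => // a; apply: isC_closed.
  move=> _ [w [k [-> mw Sk]]] /=; apply: ok_lam.
    by apply: (cand_good (candidate_arrow cA cB)); exists w, k.
  have -> : lsub w (xsubst (lup s) (fun a => xlshift (m a)) (emb u)) =
            xsubst (scons w s) m (emb u).
    rewrite /lsub xsubst_xsubst; apply: xsubst_ext => [[|x]|a] //=.
      exact: lsub_lshift.
    exact: lsub_lshift.
  have [|||//|_] := IH th rho (scons w s) m v; last by apply.
  + by case: mw => cw _ [|x] //=.
  + by [].
  + by move=> [|x] C /=; [case=> <- | apply: hG].
- move=> G1 G2 G D1 D2 D u w A B hG hD _ IHu _ IHw th rho s m v cs cm vG vD.
  apply: member_app (interp_cand _ _ v) _ _ _; first exact: interp_cand.
    by apply: IHu => // [x C e|a C e]; [apply: vG; apply/hG; left | apply: vD; apply/hD; left].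
  by apply: IHw => // [x C e|a C e]; [apply: vG; apply/hG; right | apply: vD; apply/hD; right].
- move=> G D u A _ IH th rho s m v cs cm vG vD.
  split; first by apply: closed_subst => // a; apply: isC_closed.
  move=> k [d Sk].
  have [||_] := IH (scons d th) rho s m v cs cm; last by apply.
  + move=> x B; rewrite /ctx_map; case e : (G x) => [C|] //= [<-].
    by rewrite interp_shift1; apply: vG.
  + move=> x B; rewrite /ctx_map; case e : (D x) => [C|] //= [<-].
    by rewrite interp_shift1; apply: vD.
- move=> G D u A a _ IH th rho s m v cs cm vG vD.
  have [c h] := IH th rho s m v cs cm vG vD; split=> // k.
  by rewrite interp_inst1 => Sk; apply: h; exists (ftsubst th a).
- move=> G D u n A _ IH th rho s m v cs cm vG vD.
  split; first by apply: closed_subst => // a; apply: isC_closed.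
  move=> k [P [h1 h2 Sk]].
  have [|||_] := IH th (scons2 n P rho) s m _ cs cm; last by apply.
  + exact: valid_scons2.
  + move=> x B; rewrite /ctx_map; case e : (G x) => [C|] //= [<-].
    by rewrite interp_shift2; apply: vG.
  + move=> x B; rewrite /ctx_map; case e : (D x) => [C|] //= [<-].
    by rewrite interp_shift2; apply: vD.
- move=> G D u n A H _ IH th rho s m v cs cm vG vD.
  have [c h] := IH th rho s m v cs cm vG vD; split=> // k.
  rewrite interp_inst2 // => Sk; apply: h.
  exists (fun l => interp H (with_params n l th) rho); split=> // [l|l l' e].
    exact: interp_cand.
  apply: interp_ext => // j; rewrite /with_params; case: ltnP => [/e //|_].
  exact: eqE_refl.
- move=> G D u A a b _ IH e th rho s m v cs cm vG vD.
  have := IH th rho s m v cs cm vG vD; rewrite !interp_inst1.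
  rewrite (interp_ext _ (th' := scons (ftsubst th b) th)) // => -[|j] /=.
    exact: eqE_subst.
  exact: eqE_refl.
- move=> G D u B _ IH th rho s m v cs cm vG vD.
  have cB := interp_cand B th v.
  split; first by apply: closed_subst => // a; apply: isC_closed.
  move=> k Sk; have g := cand_good cB Sk; apply: ok_mu => //.
  have -> : msub k (xsubst (fun x => xmshift (s x)) (mup m) (emb u)) =
            xsubst s (scons k m) (emb u).
    rewrite /msub xsubst_xsubst; apply: xsubst_ext => [x|[|a]] //=.
      exact: msub_mshift.
    exact: msub_mshift.
  have [|//||_ h] := IH th rho s (scons k m) v cs.
  + by move=> [|a] //=; apply: good_isC.
  + by move=> [|a] C /=; [case=> <- | apply: vD].
  by apply: ok_reds (h _ erefl) _; apply/xreds_contract/X_bot.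
Qed.
End Interp.

Lemma typed_subst_ext (F : Type) (ar : F -> nat) (E : fterm ar -> fterm ar -> Prop)
    G D t A : typed E G D t A -> forall s m s' m',
  (forall x, G x <> None -> s x = s' x) -> (forall a, D a <> None -> m a = m' a) ->
  xsubst s m (emb t) = xsubst s' m' (emb t).
Proof.
elim=> {G D t A} //=.
- by move=> G D x A e s m s' m' hs _; apply: hs; rewrite e.
- by move=> G D a B e s m s' m' _ hm; apply: hm; rewrite e.
- move=> G D u A B _ IH s m s' m' hs hm; rewrite (IH _ _ (lup s') (fun a => xlshift (m' a))) //.
    by move=> [|x] //= /hs->.
  by move=> a /hm->.
- move=> G1 G2 G D1 D2 D u v A B hG hD _ IHu _ IHv s m s' m' hs hm.
  rewrite (IHu _ _ s' m') ?(IHv _ _ s' m') // => x h.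
  + by apply: hs; case e : (G2 x) h => [C|] // _; have /hG -> : G1 x = Some C \/ G2 x = Some C by right.
  + by apply: hm; case e : (D2 x) h => [C|] // _; have /hD -> : D1 x = Some C \/ D2 x = Some C by right.
  + by apply: hs; case e : (G1 x) h => [C|] // _; have /hG -> : G1 x = Some C \/ G2 x = Some C by left.
  + by apply: hm; case e : (D1 x) h => [C|] // _; have /hD -> : D1 x = Some C \/ D2 x = Some C by left.
- move=> G D u A _ IH s m s' m' hs hm; apply: IH => x h; [apply: hs|apply: hm];
  by move: h; rewrite /ctx_map; case: (_ x).
- move=> G D u n A _ IH s m s' m' hs hm; apply: IH => x h; [apply: hs|apply: hm];
  by move: h; rewrite /ctx_map; case: (_ x).
- move=> G D u B _ IH s m s' m' hs hm.
  rewrite (IH _ _ (fun x => xmshift (s' x)) (mup m')) //.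
    by move=> x /hs->.
  by move=> [|a] //= /hm->.
Qed.

(** * Integers *)

Section Ent.
Variables (F : Type) (ar : F -> nat) (E : fterm ar -> fterm ar -> Prop).
Hypothesis hnum : forall n m : nat, n <> m -> ~ eqE E (numeral n) (numeral m).

(* On an individual which is not a numeral the predicate is [Bot], whose
   elements have no value and can thus be sent to any integer by [Next]. *)
Definition num_pred (l : nat -> fterm ar) : stacks := fun k =>
  (exists2 n, eqE E (l 0) (numeral n) & k = Base (Some n)) \/
  (~ (exists n, eqE E (l 0) (numeral n)) /\ k = Base None).

Lemma num_pred_base l k : num_pred l k -> exists o, k = Base o.
Proof. by case=> [[n _ ->]|[_ ->]]; eexists. Qed.

Lemma candidate_num l : candidate (num_pred l).
Proof.
split=> [|k /num_pred_base [o ->]]; last exact: good_base.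
have [[n e]|h] := classic (exists n, eqE E (l 0) (numeral n)).
  by exists (Base (Some n)); left; exists n.
by exists (Base None); right.
Qed.

Lemma num_pred_inv l l' : (forall j, j < 1 -> eqE E (l j) (l' j)) ->
  num_pred l = num_pred l'.
Proof.
move=> /(_ 0 isT) e; apply: stacks_ext => k.
have h n : eqE E (l 0) (numeral n) <-> eqE E (l' 0) (numeral n).
  by split=> h; apply: eqE_trans h => //; apply: eqE_sym.
split=> -[[n /h e' ->]|[e' ->]]; try by left; exists n.
  by right; split=> // -[n /h e2]; apply: e'; exists n.
by right; split=> // -[n /h e2]; apply: e'; exists n.
Qed.

Lemma num_predP l n k : eqE E (l 0) (numeral n) -> num_pred l k -> k = Base (Some n).
Proof.
move=> e [[m e' ->]|[[]]]; last by exists n.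
have [->//|/eqP ne] := eqVneq m n.
by case: (hnum ne); apply: eqE_trans e; apply: eqE_sym.
Qed.

Lemma Ent_stack n th rho : valid E rho ->
  interp E (Ent (numeral n)) th rho (Push Zero (Push Next (Base (Some n)))).
Proof.
move=> v; exists num_pred; split.
- exact: candidate_num.
- exact: num_pred_inv.
have fargE (a : fterm ar) th' : fargs (fun _ : 'I_1 => a) th' 0 = ftsubst th' a.
  by rewrite /fargs insubT.
have numE th' m : ftsubst th' (numeral m) = numeral m :> fterm ar.
  by elim: m => //= m ->.
exists Zero, (Push Next (Base (Some n))); split=> //.
  split=> // k hk; rewrite (num_predP (n := 0) _ hk); first exact: ok_zero.
  by rewrite fargE; apply: eqE_refl.
exists Next, (Base (Some n)); split=> //; last first.
  by left; exists n => //; rewrite fargE numE; apply: eqE_refl.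
split=> // _ [d [w [k [-> mw hk]]]].
have [o ek] := num_pred_base hk; subst k.
have ow := member_okv (candidate_num _) mw.
case: mw => cw mw; apply: ok_next => // w' hw.
have [[m e]|h] := classic (exists n, eqE E d (numeral n)).
  have [->] : Base o = Base (Some m.+1).
    by apply: num_predP hk; rewrite fargE /=; apply: eqE_succ.
  have ok_w : ok (XApp (Base (Some m)) w).
    by apply: mw; left; exists m => //; rewrite fargE.
  have /ok_local/local_progress := ok_reds ok_w (xreds_appr _ hw).
  case/(_ (Base (Some m)) w' isT erefl) => [hm|ha]; last by right; apply: answers_appr.
  by left; apply: xreds_appr.
have ok_w : ok (XApp (Base None) w).
  by apply: mw; right; split=> // -[m]; rewrite fargE => e; apply: h; exists m.
have /ok_local/local_progress := ok_reds ok_w (xreds_appr _ hw).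
by case/(_ (Base None) w' isT erefl) => // ha; right; apply: answers_appr.
Qed.
End Ent.

Lemma reds_lam u u' : reds u u' -> reds (Lam u) (Lam u').
Proof.
elim=> {u u'} [u u' h|u|u v w _ h1 _ h2].
- exact/rt_step/red_lam.
- exact: rt_refl.
- exact: rt_trans h1 h2.
Qed.

Lemma normal_reds t u : normal t -> reds t u -> u = t.
Proof.
move=> n h; case: (clos_rt_rt1n _ _ _ _ h) n => // y z r _ n; by case: (n _ r).
Qed.

Lemma normal_church n : normal (church n).
Proof.
move=> t h; rewrite /church in h.
inversion h as [? ? c|? u h1| | |]; subst; first by inversion c.
inversion h1 as [? ? c|? u1 h2| | |]; subst; first by inversion c.
elim: n u1 h2 {h h1} => [|n IH] u h /=; first by inversion h as [? ? c| | | |]; subst; inversion c.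
inversion h as [? ? c| | |? ? ? h1|? ? ? h1]; subst; first by inversion c.
  by inversion h1 as [? ? c| | | |]; subst; inversion c.
exact: IH h1.
Qed.

Lemma xnum_inv u n : xnum n = xsubst (scons Next (scons Zero XL)) XM (emb u) ->
  u = iter n (App (Lvar 0)) (Lvar 1).
Proof.
elim: n u => [|n IH] [[|[|x]]|a|u|u|u v] //= [e /IH ->].
by case: u e => [[|[|x]]|||| ].
Qed.

Lemma ok_church n t (k := Push Zero (Push Next (Base (Some n)))) :
  good k -> ok (XApp k (emb t)) -> reds t (church n).
Proof.
move=> g o; have g2 : good (Push Next (Base (Some n))) by inversion g.
have leaf0 x : lleaf (scons Zero XL x) by case: x.
have leaf1 x : lleaf (scons Next (scons Zero XL) x) by case: x => [|[]].
have [u hu] : exists u, reds t (Lam u).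
  have p : progress k (xsubst XL XM (emb t)).
    by rewrite xsubst_id; apply: (local_progress (ok_local o)).
  case: (pure_progress (s := XL) (fun=> isT) p) => // -[[u]|]; rewrite xsubst_id => /reds_emb_inv [t' ht e].
    by case: (emb_eq_lam (esym e)) => u' eu _; exists u'; rewrite -eu.
  by case: t' ht e.
have {}o : ok (XApp (Push Next (Base (Some n))) (lsub Zero (emb u))).
  apply: ok_reds o _; apply: xreds_trans (xreds_appr _ (reds_emb true hu)) _.
  apply: xreds_trans (xreds_push _ g _) _ => //.
  exact/xreds_appr/xreds_contract/X_lam.
have [u2 hu2] : exists u2, reds u (Lam u2).
  have p : progress (Push Next (Base (Some n))) (lsub Zero (emb u)).
    exact: (local_progress (ok_local o)).
  case: (pure_progress leaf0 p) => // -[[w]|] /(reds_subst_emb leaf0) [t' ht e].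
    case: (subst_eq_lam leaf0 (m := XM) (fun=> isT) (esym e)) => w' e' _.
    by case: (emb_eq_lam e') => u' eu _; exists u'; rewrite -eu.
  by case: t' ht e => //= -[].
have {}o : ok (XApp (Base (Some n)) (xsubst (scons Next (scons Zero XL)) XM (emb u2))).
  apply: ok_reds o _.
  apply: xreds_trans (xreds_appr _ (xreds_subst _ _ (reds_emb true hu2))) _ => //.
  apply: xreds_trans (xreds_push _ g2 _) _ => //.
  apply/xreds_appr; apply: xreds_trans (xreds_contract (X_lam _ _ _)) _.
  rewrite /lsub xsubst_xsubst.
  rewrite (@xsubst_ext _ _ (scons Next (scons Zero XL)) XM) // => -[|[|x]] //=.
have p := local_progress (ok_local o) (k := Base (Some n)) isT erefl.
have [t' ht /xnum_inv e] := reds_subst_emb leaf1 (pure_progress leaf1 p).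
apply: rt_trans hu _; apply: reds_lam; apply: rt_trans hu2 _; apply: reds_lam.
by rewrite -e.
Qed.

Theorem theorem8 (F : Type) (ar : F -> nat) (E : fterm ar -> fterm ar -> Prop)
  (hnum : forall n m : nat, n <> m -> ~ eqE E (numeral n) (numeral m))
  (hbool : ~ eqE E FBool0 FBool1)
  (n : nat) (t : term)
  (ht : typed E empty empty t (Ent (numeral n))) :
  reds_to_set t (fun u => u = church n).
Proof.
have ct : closed (emb t).
  by move=> s m; rewrite (typed_subst_ext (s' := XL) (m' := XM) ht) // xsubst_id.
pose rho (_ _ : nat) (_ : nat -> fterm ar) : stacks := fun k => k = Base None.
have v : valid E rho by split=> // *; apply: candidate_bot.
have hs := Ent_stack hnum n FVar v.
have g := cand_good (interp_cand _ _ v) hs.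
have [_ /(_ _ hs)] : member (interp E (Ent (numeral n)) FVar rho) (emb t).
  rewrite -(ct (fun=> Zero) (fun=> Base None)).
  exact: (adequacy ht v).
move=> o; split=> [u ->|u ->|u nu tu].
- exact: normal_church.
- exact: ok_church o.
- have ou := ok_reds o (xreds_appr _ (reds_emb true tu)).
  by rewrite (normal_reds nu (ok_church g ou)).
Qed.
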